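(* Let $F(\mathbf z)=\sum_{\mathbf s\in\mathbb N^d}a_{\mathbf s}\mathbf z^{\mathbf s}$ be a $d$-variate power series with nonnegative coefficients such that $a_{\mathbf s}=0$ whenever $\mathbf s/s_d$ lies outside some compact set $K$, and assume the logarithmic domain of convergence $\log\mathcal D$ of $F$ is strictly convex. Let $f(x)=F(1,\dots,1,x)$ and suppose $f$ has a unique singularity $x_0$ of minimal modulus, which is a simple pole. Let $\mathbf x=(1,\dots,1,x_0)$ and suppose $F$ is meromorphic in a neighborhood of the closed polydisk $\mathbf D(\mathbf x)$, written there as $F=G/H$ with $G,H$ analytic, relatively prime, and $H$ square-free. Let $\overline{\mathbf r}=\mathrm{dir}(\mathbf x)$ be the projective class of $\left(x_1\frac{\partial H}{\partial x_1}(\mathbf x),\dots,x_d\frac{\partial H}{\partial x_d}(\mathbf x)\right)$, and let $\mathbf r^*=(r_1/r_d,\dots,r_{d-1}/r_d)$ for a representative $\mathbf r$ of $\overline{\mathbf r}$. Then the measures $\mu_k$ satisfy a weak law of large numbers with mean vector $\mathbf r^*$: for every $\varepsilon>0$, $$\lim_{k\to\infty}\mu_k\left\{(s_1,\dots,s_{d-1}):\left|\tfrac{(s_1,\dots,s_{d-1})}{k}-\mathbf r^*\right|>\varepsilon\right\}=0.$$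
   Context: $\mathcal D$ is the open domain of convergence of $F$; $\log\mathcal D=\{\mathbf y\in\mathbb R^d:(e^{y_1},\dots,e^{y_d})\in\mathcal D\}$, and strictly convex means its boundary contains no line segment. $\mathbf D(\mathbf x)=\{\mathbf z:|z_i|\le|x_i|\ \forall i\}$. For each $k$ let $C_k=\sum_{\mathbf s:s_d=k}a_{\mathbf s}$ (finite by the hypothesis on $K$); the slice distribution $\mu_k$ is the probability measure on $(d-1)$-vectors giving mass $a_{\mathbf s}/C_k$ to $(s_1,\dots,s_{d-1})$ for each $\mathbf s$ with $s_d=k$. *)

(* Defs.v *)
From HB Require Import structures.
From mathcomp Require Import all_boot all_order all_algebra finmap.
From mathcomp Require Import all_classical all_reals all_analysis.
From mathcomp.analysis.showcase Require summability.
From mathcomp.real_closed Require Import complex.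

Set Implicit Arguments.
Unset Strict Implicit.
Unset Printing Implicit Defensive.

Import Order.TTheory GRing.Theory Num.Theory.
Import numFieldNormedType.Exports.

Local Open Scope classical_set_scope.
Local Open Scope complex_scope.
Local Open Scope ring_scope.

(* R[i] as a bundled numClosedFieldType: it then inherits from
   numFieldNormedType the topology of the modulus, which mathcomp-real-closed
   does not provide for R[i] itself. *)
Definition Cplx (R : realType) : numClosedFieldType := R[i].

Definition ofR (R : realType) (x : R) : Cplx R := x%:C.

(* The modulus as a real number: [`|z|] lives in [Cplx R]. *)
Definition cabs (R : realType) (z : Cplx R) : R := complex.Re `|z|.

Definition multiindex (d : nat) := {ffun 'I_d -> nat}.

Definition monomial (R : realType) (d : nat) (z : 'rV[Cplx R]_d)
    (s : multiindex d) : Cplx R :=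
  \prod_(i < d) z 0 i ^+ s i.

(* Unconditional convergence, i.e. along the net of finite index sets. *)
Definition has_sum (R : realType) (I : choiceType) (u : I -> Cplx R) (l : Cplx R) :=
  summability.partial_sum u @ summability.totally --> l.

Definition analytic_at (R : realType) (d : nat) (g : 'rV[Cplx R]_d -> Cplx R)
    (p : 'rV[Cplx R]_d) :=
  exists c : multiindex d -> Cplx R,
    \forall z \near p, has_sum (fun s => c s * monomial (z - p) s) (g z).

Definition analytic_on (R : realType) (d : nat) (U : set 'rV[Cplx R]_d)
    (g : 'rV[Cplx R]_d -> Cplx R) :=
  forall p, U p -> analytic_at g p.

Definition analytic1_at (R : realType) (g : Cplx R -> Cplx R) (p : Cplx R) :=
  exists c : nat -> Cplx R,
    \forall z \near p, series (fun k => c k * (z - p) ^+ k) @ \oo --> g z.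

(* Divisibility, units, coprimality and square-freeness in the ring of analytic
   functions on U; only the values on U matter. *)
Definition analytic_dvd (R : realType) (d : nat) (U : set 'rV[Cplx R]_d)
    (W g : 'rV[Cplx R]_d -> Cplx R) :=
  exists2 Q, analytic_on U Q & forall z, U z -> g z = W z * Q z.

Definition analytic_unit (R : realType) (d : nat) (U : set 'rV[Cplx R]_d)
    (W : 'rV[Cplx R]_d -> Cplx R) :=
  analytic_dvd U W (fun=> 1).

Definition relatively_prime (R : realType) (d : nat) (U : set 'rV[Cplx R]_d)
    (G H : 'rV[Cplx R]_d -> Cplx R) :=
  forall W, analytic_on U W -> analytic_dvd U W G -> analytic_dvd U W H ->
    analytic_unit U W.

Definition square_free (R : realType) (d : nat) (U : set 'rV[Cplx R]_d)
    (H : 'rV[Cplx R]_d -> Cplx R) :=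
  forall W, analytic_on U W -> analytic_dvd U (fun z => W z ^+ 2) H ->
    analytic_unit U W.

Definition psterm (R : realType) (d : nat) (a : multiindex d -> R)
    (z : 'rV[Cplx R]_d) (s : multiindex d) : Cplx R :=
  ofR (a s) * monomial z s.

Definition abs_convergent (R : realType) (d : nat) (a : multiindex d -> R)
    (z : 'rV[Cplx R]_d) :=
  (\esum_(s in [set: multiindex d]) (cabs (psterm a z s))%:E < +oo)%E.

(* The sum F(z) of the power series; meaningful where the series converges. *)
Definition psum (R : realType) (d : nat) (a : multiindex d -> R)
    (z : 'rV[Cplx R]_d) : Cplx R :=
  summability.sum (psterm a z).

Definition convergence_domain (R : realType) (d : nat) (a : multiindex d -> R) :
    set 'rV[Cplx R]_d :=
  [set z | abs_convergent a z]°.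

Definition log_domain (R : realType) (d : nat) (a : multiindex d -> R) :
    set 'rV[R]_d :=
  [set y | convergence_domain a (\row_i ofR (expR (y 0 i)))].

Definition boundary (T : topologicalType) (A : set T) : set T :=
  closure A `\` A°.

(* The domain to which this is applied, a logarithmic domain of convergence, is
   always convex, so only the absence of boundary segments is required. *)
Definition strictly_convex (R : realType) (d : nat) (A : set 'rV[R]_d) :=
  forall p q : 'rV[R]_d, p != q ->
    ~ (forall t : R, 0 <= t <= 1 -> boundary A ((1 - t) *: p + t *: q)).

Definition closed_polydisk (R : realType) (d : nat) (x : 'rV[Cplx R]_d) :
    set 'rV[Cplx R]_d :=
  [set z | forall i, `|z 0 i| <= `|x 0 i|].

(* s / s_d lies in K.  For s_d = 0 and s <> 0 the quotient is at infinity, hence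
   outside every compact K; the index s = 0, where the quotient is undefined,
   is not constrained. *)
Definition ratio_in (R : realType) (n : nat) (K : set 'rV[R]_n.+1)
    (s : multiindex n.+1) :=
  if s ord_max == 0%N then s = [ffun=> 0%N]
  else K (\row_i ((s i)%:R / (s ord_max)%:R)).

(* The point (1, ..., 1, t). *)
Definition ones_last (R : realType) (n : nat) (t : Cplx R) : 'rV[Cplx R]_n.+1 :=
  \row_i (if i == ord_max then t else 1).

(* The function f, known on the disk |t| < |p|, continues analytically to a
   neighborhood of the boundary point p. *)
Definition regular_at (R : realType) (f : Cplx R -> Cplx R) (p : Cplx R) :=
  exists2 g, analytic1_at g p &
    \forall t \near p, `|t| < `|p| -> f t = g t.

(* E is the set where f is defined: f is analytic on the disk |t| < |x0|, and x0
   is its only singularity on the circle |t| = |x0|. *)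
Definition unique_minimal_singularity (R : realType) (E : set (Cplx R))
    (f : Cplx R -> Cplx R) (x0 : Cplx R) :=
  [/\ x0 != 0,
      forall t, `|t| < `|x0| -> E t /\ analytic1_at f t,
      ~ regular_at f x0 &
      forall t, `|t| = `|x0| -> t != x0 -> regular_at f t].

Definition simple_pole (R : realType) (f : Cplx R -> Cplx R) (x0 : Cplx R) :=
  exists h, [/\ analytic1_at h x0, h x0 != 0 &
    \forall t \near x0, `|t| < `|x0| -> f t = h t / (t - x0)].

Definition log_gradient (R : realType) (n : nat) (H : 'rV[Cplx R]_n.+1 -> Cplx R)
    (x : 'rV[Cplx R]_n.+1) : 'rV[Cplx R]_n.+1 :=
  \row_i (x 0 i * 'D_('e_i) H x).

(* r represents the projective class of v; the zero vector has no class. *)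
Definition represents (R : realType) (d : nat) (v r : 'rV[Cplx R]_d) :=
  v != 0 /\ exists2 c : Cplx R, c != 0 & r = c *: v.

(* (r_1 / r_d, ..., r_(d-1) / r_d) *)
Definition mean_vector (R : realType) (n : nat) (r : 'rV[Cplx R]_n.+1) :
    'rV[Cplx R]_n :=
  \row_j (r 0 (lift ord_max j) / r 0 ord_max).

Definition euclidean_norm (R : realType) (d : nat) (v : 'rV[Cplx R]_d) : R :=
  Num.sqrt (\sum_(j < d) cabs (v 0 j) ^+ 2).

(* (s_1, ..., s_(d-1)) *)
Definition initial (n : nat) (s : multiindex n.+1) : multiindex n :=
  [ffun j => s (lift ord_max j)].

(* C_k; the sum is finite when the ratios s / s_d stay in a compact set. *)
Definition slice_total (R : realType) (n : nat) (a : multiindex n.+1 -> R)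
    (k : nat) : R :=
  fine (\esum_(s in [set s : multiindex n.+1 | s ord_max = k]) (a s)%:E).

(* mu_k(A), for a nonnegative and C_k <> 0. *)
Definition slice_distribution (R : realType) (n : nat)
    (a : multiindex n.+1 -> R) (k : nat) (A : set (multiindex n)) : \bar R :=
  \esum_(s in [set s : multiindex n.+1 | s ord_max = k /\ A (initial s)])
    (a s / slice_total a k)%:E.

(* Main.v *)
(* Write C_k for the slice totals, so f(t) = sum_k C_k t^k.  Subtracting the
   polar part at x0 from f leaves a function bounded on the disk |t| < |x0|; by
   Parseval its coefficients are square-summable after rescaling, whence x0 > 0
   and C_k x0^k tends to a positive limit.  Now fix a coordinate j and let
   rho(l) be the radius of convergence in t of F(1, .., e^l, .., 1, t), with e^l
   in position j.  Its coefficients are nonnegative, so by Pringsheim's theorem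
   F cannot continue past rho(l) along the real axis, i.e. H vanishes at
   (1, .., e^l, .., 1, rho(l)).  Compactness of K gives |rho(l) - x0| = O(|l|),
   and expanding H = 0 to first order at x yields
     rho(l) / x0 = 1 - m_j l + O(l^2),   m_j = H_j(x) / (x0 H_d(x)),
   where H_d(x) = 0 would force the whole gradient to vanish.  Chernoff's bound
   with a small tilt l of either sign then shows that the proportion of slice k
   with |s_j / k - m_j| > d decays exponentially. *)
Require Import Defs.
From mathcomp Require Import all_boot all_order all_algebra finmap.
From mathcomp Require Import all_classical all_reals all_analysis.
From mathcomp.analysis.showcase Require summability.
From mathcomp.real_closed Require Import complex.
From mathcomp Require Import separable cyclic cyclotomic ring lra.
Set Implicit Arguments.
Unset Strict Implicit.
Unset Printing Implicit Defensive.
Import Order.TTheory GRing.Theory Num.Theory.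
Import numFieldNormedType.Exports.
Local Open Scope classical_set_scope.
Local Open Scope ring_scope.

(** Compactness of K does more than control rho(l): it bounds every exponent in slice k by M k, so
    each slice has finite support and the series becomes one in t alone, graded by the last
    exponent. The unordered sums of the definitions are turned into such graded partial sums.

    The obstacle is that F = G / H is known only inside the open domain of convergence and off the
    zeros of H, whereas rho(l) lies on the boundary. So rho(l) is defined not by H = 0 but as a
    supremum of arguments with bounded partial sums; a nonzero H there would push convergence
    further. Pringsheim's theorem enters for a quotient of two power series, where repeated division
    by rho - t proves it with explicit constants. Parseval likewise enters in finite form, over n-th
    roots of unity.

    An error O(l^2) in rho(l) is affordable because a deviation d gains |l| d in Chernoff's bound,
    which is linear in l. The expansion also shows that m_j is real, since l and rho(l) are. The
    positive limit of C_k x0^k serves twice: it bounds rho(l) from above, and it bounds C_k from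
    below in the final quotient. *)

Section Modulus.
Variable R : realType.
Implicit Types z w : Cplx R.

Lemma cabsE z : `|z| = ofR (cabs z).
Proof. by rewrite /cabs /ofR normc_def. Qed.

Lemma cabs_sqrt z :
  cabs z = Num.sqrt (complex.Re z ^+ 2 + complex.Im z ^+ 2).
Proof. by rewrite /cabs normc_def. Qed.

Lemma ofRI : injective (@ofR R).
Proof. by move=> x y []. Qed.

Lemma ofRD (x y : R) : ofR (x + y) = ofR x + ofR y.
Proof. exact: (rmorphD (real_complex R)). Qed.

Lemma ofRN (x : R) : ofR (- x) = - ofR x.
Proof. exact: (rmorphN (real_complex R)). Qed.

Lemma ofRB (x y : R) : ofR (x - y) = ofR x - ofR y.
Proof. exact: (rmorphB (real_complex R)). Qed.

Lemma ofRM (x y : R) : ofR (x * y) = ofR x * ofR y.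
Proof. exact: (rmorphM (real_complex R)). Qed.

Lemma ofRX (x : R) k : ofR (x ^+ k) = ofR x ^+ k.
Proof. exact: (rmorphXn (real_complex R)). Qed.

Lemma ofR0 : ofR (0 : R) = 0. Proof. by []. Qed.

Lemma ofR1 : ofR (1 : R) = 1. Proof. by []. Qed.

Lemma ofR_nat k : ofR (k%:R : R) = k%:R.
Proof. exact: (rmorph_nat (real_complex R)). Qed.

Lemma ofRV (x : R) : ofR x^-1 = (ofR x)^-1.
Proof. exact: (fmorphV (real_complex R)). Qed.

Lemma ofR_sum (I : Type) (r : seq I) (P : pred I) (F : I -> R) :
  ofR (\sum_(i <- r | P i) F i) = \sum_(i <- r | P i) ofR (F i).
Proof. exact: (rmorph_sum (real_complex R)). Qed.

Lemma ofR_eq0 (x : R) : (ofR x == 0) = (x == 0).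
Proof. by rewrite -ofR0 (inj_eq ofRI). Qed.

Lemma ofR_lt (x y : R) : (ofR x < ofR y) = (x < y).
Proof. exact: ltcR. Qed.

Lemma ofR_le (x y : R) : (ofR x <= ofR y) = (x <= y).
Proof. exact: lecR. Qed.

Lemma cabs_ge0 z : 0 <= cabs z.
Proof. by rewrite cabs_sqrt sqrtr_ge0. Qed.

Lemma cabsM z w : cabs (z * w) = cabs z * cabs w.
Proof. by apply: ofRI; rewrite ofRM -!cabsE normrM. Qed.

Lemma cabs_ofR (x : R) : cabs (ofR x) = `|x|.
Proof. by rewrite cabs_sqrt /= expr0n addr0 sqrtr_sqr. Qed.

Lemma cabs0 : cabs (0 : Cplx R) = 0.
Proof. by rewrite -ofR0 cabs_ofR normr0. Qed.

Lemma cabs1 : cabs (1 : Cplx R) = 1.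
Proof. by rewrite -ofR1 cabs_ofR normr1. Qed.

Lemma cabsN z : cabs (- z) = cabs z.
Proof. by apply: ofRI; rewrite -!cabsE normrN. Qed.

Lemma cabsB z w : cabs (z - w) = cabs (w - z).
Proof. by rewrite -cabsN opprB. Qed.

Lemma cabsX z k : cabs (z ^+ k) = cabs z ^+ k.
Proof. by apply: ofRI; rewrite ofRX -!cabsE normrX. Qed.

Lemma cabsV z : cabs z^-1 = (cabs z)^-1.
Proof.
by apply: ofRI; rewrite ofRV -!cabsE; exact: normfV.
Qed.

Lemma cabs_eq0 z : (cabs z == 0) = (z == 0).
Proof. by rewrite -ofR_eq0 -cabsE normr_eq0. Qed.

Lemma cabs_gt0 z : (0 < cabs z) = (z != 0).
Proof. by rewrite lt0r cabs_ge0 andbT cabs_eq0. Qed.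

Lemma ler_cabsD z w : cabs (z + w) <= cabs z + cabs w.
Proof. by rewrite -ofR_le ofRD -!cabsE ler_normD. Qed.

Lemma ler_cabsB z w : cabs (z - w) <= cabs z + cabs w.
Proof. by rewrite -(cabsN w) ler_cabsD. Qed.

Lemma ler_cabs_sum (I : Type) (r : seq I) (P : pred I) (F : I -> Cplx R) :
  cabs (\sum_(i <- r | P i) F i) <= \sum_(i <- r | P i) cabs (F i).
Proof.
elim/big_rec2 : _ => [|i y1 y2 _ h]; first by rewrite cabs0.
by apply: le_trans (ler_cabsD _ _) _; rewrite lerD2l.
Qed.

Lemma ler_Re_cabs z : `|complex.Re z| <= cabs z.
Proof.
rewrite cabs_sqrt -sqrtr_sqr ler_wsqrtr // lerDl; exact: sqr_ge0.
Qed.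

Lemma ler_Im_cabs z : `|complex.Im z| <= cabs z.
Proof.
rewrite cabs_sqrt -sqrtr_sqr ler_wsqrtr // lerDr; exact: sqr_ge0.
Qed.

Lemma ReD z w : complex.Re (z + w) = complex.Re z + complex.Re w.
Proof. by case: z w => [? ?] [? ?]. Qed.

Lemma ImD z w : complex.Im (z + w) = complex.Im z + complex.Im w.
Proof. by case: z w => [? ?] [? ?]. Qed.

Lemma ReN z : complex.Re (- z) = - complex.Re z.
Proof. by case: z. Qed.

Lemma ImN z : complex.Im (- z) = - complex.Im z.
Proof. by case: z. Qed.

Lemma ImZ (x : R) z : complex.Im (ofR x * z) = x * complex.Im z.
Proof. by case: z => a b /=; rewrite mul0r addr0. Qed.

Lemma cplxE z : z = ofR (complex.Re z) + 'i%C * ofR (complex.Im z).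
Proof. exact: complexE. Qed.

Lemma cabs_ReIm z : cabs z <= `|complex.Re z| + `|complex.Im z|.
Proof.
rewrite {1}(cplxE z) (le_trans (ler_cabsD _ _))// cabsM !cabs_ofR.
by rewrite cabs_sqrt /= expr0n add0r expr1n sqrtr1 mul1r.
Qed.

Lemma lt_norm_cabs z w : (`|z| < `|w|) = (cabs z < cabs w).
Proof. by rewrite !cabsE ofR_lt. Qed.

Lemma norm_lt_ofR z (e : R) : (`|z| < ofR e) = (cabs z < e).
Proof. by rewrite !cabsE ofR_lt. Qed.

(** In the partial order of [Cplx R] a positive element is real, so radii and tolerances supplied by
    filters on [Cplx R] can be exchanged for positive reals. *)
Lemma gt0_ofR z : 0 < z -> exists2 e : R, 0 < e & z = ofR e.
Proof.
move=> z0; exists (cabs z); first by rewrite cabs_gt0 gt_eqF.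
by rewrite -cabsE gtr0_norm.
Qed.

Lemma nbhs_cabs (p : Cplx R) (P : set (Cplx R)) :
  (\forall z \near p, P z) <->
  exists2 e : R, 0 < e & forall z, cabs (z - p) < e -> P z.
Proof.
split=> [/nbhs_ballP [e /= /gt0_ofR [e' e'0 ->] h]|[e e0 h]].
  exists e' => // z zp; apply: h.
  by rewrite -ball_normE /= norm_lt_ofR cabsB.
apply/nbhs_ballP; exists (ofR e) => /=; first by rewrite -ofR0 ofR_lt.
by move=> z; rewrite -ball_normE /= norm_lt_ofR cabsB => /h.
Qed.

Lemma nbhs_rV_cabs d (p : 'rV[Cplx R]_d) (P : set 'rV[Cplx R]_d) :
  (\forall z \near p, P z) <->
  exists2 e : R, 0 < e & forall z : 'rV_d, (forall i, cabs (z 0 i - p 0 i) < e) -> P z.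
Proof.
split=> [/nbhs_ballP [e /= /gt0_ofR [e' e'0 ->] h]|[e e0 h]].
  exists e' => // z zp; apply: h; split; first by rewrite -ofR0 ofR_lt.
  by move=> i j; rewrite (ord1 i) -ball_normE /= norm_lt_ofR cabsB.
apply/nbhs_ballP; exists (ofR e) => /=; first by rewrite -ofR0 ofR_lt.
move=> z [_ hz]; apply: h => i; move: (hz 0 i).
by rewrite -ball_normE /= norm_lt_ofR cabsB.
Qed.

End Modulus.

(** * Sequences and power series in the complex plane *)

Definition cvgC (R : realType) (u : nat -> Cplx R) (l : Cplx R) :=
  forall e : R, 0 < e -> exists N, forall n, (N <= n)%N -> cabs (u n - l) < e.

(** Terms are compared with the single term at [N]; by the triangle inequality this is the Cauchy
    condition, in the form that tails of series deliver. *)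
Definition cauchyC (R : realType) (u : nat -> Cplx R) :=
  forall e : R, 0 < e -> exists N, forall n, (N <= n)%N -> cabs (u n - u N) < e.

Definition polysum (R : realType) (c : nat -> Cplx R) (z : Cplx R) (n : nat) :=
  \sum_(k < n) c k * z ^+ k.

Section Sequences.
Variable R : realType.
Implicit Types (u v c : nat -> Cplx R) (l z p : Cplx R) (w : nat -> R).

Lemma cvgCP u l : u @ \oo --> l <-> cvgC u l.
Proof.
split=> [/cvgrPdist_lt h e e0|h].
  have e0' : 0 < ofR e by rewrite -ofR0 ofR_lt.
  have [N _ hN] := h _ e0'.
  exists N => n Nn; have := hN n Nn.
  by rewrite /= norm_lt_ofR cabsB.
apply/cvgrPdist_lt => e /gt0_ofR[e' e'0 ->].
have [N hN] := h _ e'0; exists N => // n /= Nn.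
by rewrite norm_lt_ofR cabsB hN.
Qed.

Lemma cvgC_ext u v l : u =1 v -> cvgC u l -> cvgC v l.
Proof.
by move=> uv ul e e0; have [N h] := ul _ e0; exists N => n; rewrite -uv; exact: h.
Qed.

Lemma cvgC_shift u l k : cvgC (fun n => u (n + k)%N) l -> cvgC u l.
Proof.
move=> ul e e0; have [N h] := ul _ e0; exists (N + k)%N => n Nn.
have kn : (k <= n)%N by exact: leq_trans (leq_addl _ _) Nn.
rewrite -(subnK kn); apply: h; by rewrite leq_subRL // addnC.
Qed.

Lemma cvgC_shiftr k u l : cvgC u l -> cvgC (fun n => u (n + k)%N) l.
Proof.
move=> ul e e0; have [N h] := ul _ e0; exists N => n Nn.
by apply: h; rewrite (leq_trans Nn)// leq_addr.
Qed.

Lemma cvgC_cst l : cvgC (fun=> l) l.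
Proof. by move=> e e0; exists 0%N => n _; rewrite subrr cabs0. Qed.

Lemma cvgCD u v l l' : cvgC u l -> cvgC v l' -> cvgC (fun n => u n + v n) (l + l').
Proof.
move=> ul vl e e0; have e20 : 0 < e / 2 by lra.
have [N h] := ul _ e20; have [N' h'] := vl _ e20.
exists (maxn N N') => n; rewrite geq_max => /andP[/h a /h' b].
have -> : u n + v n - (l + l') = (u n - l) + (v n - l') by ring.
by have := ler_cabsD (u n - l) (v n - l'); lra.
Qed.

Lemma cvgCZ u l z : cvgC u l -> cvgC (fun n => z * u n) (z * l).
Proof.
move=> ul e e0.
have p0 : 0 < cabs z + 1 by have := cabs_ge0 z; lra.
have [N h] := ul _ (divr_gt0 e0 p0).
exists N => n Nn; rewrite -mulrBr cabsM.
have := h _ Nn; rewrite ltr_pdivlMr // => a.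
apply: le_lt_trans a; rewrite mulrC; apply: ler_wpM2l; first exact: cabs_ge0.
by lra.
Qed.

Lemma cvgCN u l : cvgC u l -> cvgC (fun n => - u n) (- l).
Proof.
move=> ul e e0; have [N h] := ul _ e0; exists N => n /h.
by rewrite -cabsN; congr (cabs _ < _); ring.
Qed.

Lemma cvgCB u v l l' : cvgC u l -> cvgC v l' -> cvgC (fun n => u n - v n) (l - l').
Proof. by move=> ul vl; apply: cvgCD ul (cvgCN vl). Qed.

Lemma cvgC_le u l (B : R) : cvgC u l ->
  (exists N, forall n, (N <= n)%N -> cabs (u n) <= B) -> cabs l <= B.
Proof.
move=> ul [N h]; rewrite leNgt; apply/negP => Bl.
have e0 : 0 < cabs l - B by lra.
have [N' h'] := ul _ e0.
have := h (maxn N N') (leq_maxl _ _); have := h' (maxn N N') (leq_maxr _ _).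
set a := u _ => h1 h2.
have := ler_cabsB a (a - l); have -> : a - (a - l) = l by ring.
lra.
Qed.

Lemma cvgC_unique u l l' : cvgC u l -> cvgC u l' -> l = l'.
Proof.
move=> ul ul'; have h := cvgCB ul ul'.
apply/eqP; rewrite -subr_eq0 -cabs_eq0; apply/eqP/le_anti.
rewrite cabs_ge0 andbT; apply: (cvgC_le h).
by exists 0%N => n _; rewrite subrr cabs0.
Qed.

(** Real and imaginary parts are 1-Lipschitz for the modulus, so completeness of the reals applies
    to each. *)
Lemma cauchyC_cvg u : cauchyC u -> exists l, cvgC u l.
Proof.
move=> cu.
have real_cvg (f : Cplx R -> R) : (forall z z', `|f z - f z'| <= cabs (z - z')) ->
    exists l : R, (fun n => f (u n)) @ \oo --> l.
  move=> fL.
  have cf : cauchy ((fun n => f (u n)) @ \oo).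
    apply: cauchy_exP => e e0.
    have [N h] := cu e e0; exists (f (u N)), N => // n /= Nn.
    rewrite -ball_normE /=; apply: le_lt_trans (fL _ _) _.
    by rewrite cabsB; exact: h.
  exists (lim ((fun n => f (u n)) @ \oo)); exact: cauchy_cvg.
have [a ha] : exists l : R, (fun n => complex.Re (u n)) @ \oo --> l.
  by apply: real_cvg => z z'; rewrite -ReN -ReD ler_Re_cabs.
have [b hb] : exists l : R, (fun n => complex.Im (u n)) @ \oo --> l.
  by apply: real_cvg => z z'; rewrite -ImN -ImD ler_Im_cabs.
exists (a +i* b)%C => e e0.
move/cvgrPdist_lt: ha => /(_ (e / 2) ltac:(lra)) [N _ hN].
move/cvgrPdist_lt: hb => /(_ (e / 2) ltac:(lra)) [N' _ hN'].
exists (maxn N N') => n; rewrite geq_max => /andP[/hN /= h /hN' /= h'].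
apply: le_lt_trans (cabs_ReIm _) _.
rewrite ReD ReN ImD ImN /= distrC (distrC _ b); lra.
Qed.

(** [N] is an index where the partial sum comes within [e] of the supremum of all partial sums. *)
Lemma bounded_tail w (B : R) : (forall k, 0 <= w k) ->
  (forall n, \sum_(k < n) w k <= B) ->
  forall e : R, 0 < e -> exists N, forall n, (N <= n)%N -> \sum_(N <= k < n) w k < e.
Proof.
move=> w0 wB e e0.
pose S := range (fun n => \sum_(k < n) w k).
have supS : has_sup S.
  by split; [exists (\sum_(k < 0) w k), 0%N|exists B => _ [n _ <-]].
have [_ [N _ <-] hN] := sup_adherent e0 supS.
exists N => n Nn.
have : \sum_(k < n) w k <= sup S by apply: ub_le_sup; [case: supS|exists n].
rewrite -!(big_mkord xpredT w) (big_cat_nat (leq0n N) Nn) /=.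
move: hN; rewrite -!(big_mkord xpredT w); lra.
Qed.

Lemma abs_series_cauchy u (B : R) : (forall n, \sum_(k < n) cabs (u k) <= B) ->
  cauchyC (fun n => \sum_(k < n) u k).
Proof.
move=> uB e e0.
have [N h] := bounded_tail (fun k => cabs_ge0 (u k)) uB e0.
exists N => n Nn; apply: le_lt_trans (h n Nn).
rewrite -!(big_mkord xpredT u) (big_cat_nat (leq0n N) Nn) /= addrAC subrr add0r.
exact: ler_cabs_sum.
Qed.

Lemma cvgC_bounded u l : cvgC u l -> exists2 B : R, 0 < B & forall n, cabs (u n) <= B.
Proof.
move=> /(_ 1 ltr01) [N h].
exists (\sum_(n < N) cabs (u n) + cabs l + 1).
  have := cabs_ge0 l; have : 0 <= \sum_(n < N) cabs (u n).
    by apply: sumr_ge0 => i _; exact: cabs_ge0.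
  lra.
move=> n; have := cabs_ge0 l => l0.
have s0 : 0 <= \sum_(n < N) cabs (u n) by apply: sumr_ge0 => i _; exact: cabs_ge0.
have [/h a|nN] := leqP N n.
  have := ler_cabsD (u n - l) l; rewrite subrK; lra.
have : cabs (u n) <= \sum_(n < N) cabs (u n).
  rewrite (bigD1 (Ordinal nN)) //= lerDl.
  by apply: sumr_ge0 => i _; exact: cabs_ge0.
lra.
Qed.

Lemma term_bounded u l : cvgC (fun n => \sum_(k < n) u k) l ->
  exists2 B : R, 0 < B & forall k, cabs (u k) <= B.
Proof.
move=> /cvgC_bounded [B B0 h]; exists (B + B); first by lra.
move=> k; have := ler_cabsB (\sum_(i < k.+1) u i) (\sum_(i < k) u i).
have -> : \sum_(i < k.+1) u i - \sum_(i < k) u i = u k.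
  by rewrite big_ord_recr /=; ring.
have := h k; have := h k.+1; lra.
Qed.

Lemma geometric_le (q : R) n : 0 <= q < 1 -> \sum_(k < n) q ^+ k <= (1 - q)^-1.
Proof.
move=> /andP[q0 q1]; have p : 0 < 1 - q by lra.
rewrite -[leRHS]mul1r ler_pdivlMr // mulrC -opprB mulNr -subrX1.
have := exprn_ge0 n q0; lra.
Qed.

(** Within half the radius each term is at most B / 2^k, and the geometric series gives the factor
    2. *)
Lemma half_pow_sum (B r : R) c z n : 0 < r -> 0 <= B ->
  (forall k, cabs (c k) * r ^+ k <= B) -> cabs z <= r / 2 ->
  \sum_(k < n) cabs (c k * z ^+ k) <= 2 * B.
Proof.
move=> r0 B0 cB zr.
apply: (@le_trans _ _ (\sum_(k < n) B * (2^-1) ^+ k)).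
  apply: ler_sum => k _; rewrite cabsM cabsX.
  apply: (@le_trans _ _ (cabs (c k) * (r / 2) ^+ k)).
    apply: ler_wpM2l; first exact: cabs_ge0.
    by rewrite lerXn2r ?nnegrE ?cabs_ge0 //; lra.
  rewrite exprMn mulrA; apply: ler_wpM2r; last exact: cB.
  by apply: exprn_ge0; lra.
rewrite -mulr_sumr mulrC ler_wpM2r //.
apply: (le_trans (@geometric_le 2^-1 n _)); first by apply/andP; split; lra.
have -> : 1 - 2^-1 = 2^-1 :> R by lra.
by rewrite invrK.
Qed.

Lemma polysumS c z n :
  polysum c z n.+1 = c 0%N + z * polysum (fun k => c k.+1) z n.
Proof.
rewrite /polysum big_ord_recl /= expr0 mulr1 mulr_sumr; congr (_ + _).
by apply: eq_bigr => i _; rewrite /bump /= add1n exprS; ring.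
Qed.

(** Past the constant term a factor z comes out, and the shifted coefficients obey the same kind of
    bound with D / r in place of D. *)
Lemma polysum_dist0 (D r : R) c z l : 0 < r -> 0 <= D ->
  (forall k, cabs (c k) * r ^+ k <= D) -> cabs z <= r / 2 ->
  cvgC (polysum c z) l -> cabs (l - c 0%N) <= 2 * (D / r) * cabs z.
Proof.
move=> r0 D0 cD zr h.
apply: (cvgC_le (cvgCB h (cvgC_cst (c 0%N)))).
exists 1%N => -[//|n] _; rewrite polysumS addrC addKr cabsM mulrC.
apply: ler_wpM2r; first exact: cabs_ge0.
apply: le_trans (ler_cabs_sum _ _ _) _.
apply: (@half_pow_sum (D / r) r (fun k => c k.+1)) => //.
  by apply: divr_ge0 => //; exact: ltW.
move=> k; rewrite ler_pdivlMr //.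
by have := cD k.+1; rewrite exprS [r * _]mulrC mulrA.
Qed.

Lemma power_series_lipschitz c (g : Cplx R -> Cplx R) p (e : R) : 0 < e ->
  (forall z, cabs (z - p) < e -> cvgC (polysum c (z - p)) (g z)) ->
  exists B : R, exists2 r : R, 0 < r < e &
    forall z, cabs (z - p) <= r ->
      cabs (g z) <= B /\ cabs (g z - g p) <= B * cabs (z - p).
Proof.
move=> e0 h.
have e2 : `|e / 2| = e / 2 by rewrite ger0_norm //; lra.
have hc : cabs (ofR (e / 2) + p - p) < e by rewrite addrK cabs_ofR e2; lra.
have := h _ hc; rewrite addrK => hs.
have [B B0 hB] := term_bounded (u := fun k => c k * ofR (e / 2) ^+ k) hs.
have cB k : cabs (c k) * (e / 2) ^+ k <= B.
  by have := hB k; rewrite cabsM cabsX cabs_ofR e2.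
(* The coefficients are controlled at radius e / 2, and e / 4 is half of it. The first summand
   bounds [g], the second its increments; their sum serves for both. *)
exists (2 * B + 2 * (2 * B / e)), (e / 4); first by apply/andP; split; lra.
move=> z hz.
have ez : cabs (z - p) < e by lra.
have gp : g p = c 0%N.
  have := h p; rewrite subrr cabs0 => /(_ e0) /cvgC_unique; apply.
  apply: (cvgC_shift (k := 1)); apply: cvgC_ext (cvgC_cst _) => n.
  by rewrite addn1 polysumS mul0r addr0.
have q0 : 0 < 2 * B / e by apply: divr_gt0; lra.
split.
  have : cabs (g z) <= 2 * B; last by lra.
  apply: (cvgC_le (h z ez)); exists 0%N => n _.
  apply: le_trans (ler_cabs_sum _ _ _) _.
  by apply: (@half_pow_sum B (e / 2)) => //; lra.
have : cabs (g z - g p) <= 2 * (B / (e / 2)) * cabs (z - p).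
  by rewrite gp; apply: polysum_dist0 (h z ez) => //; lra.
have -> : 2 * (B / (e / 2)) = 2 * (2 * B / e) by field; rewrite gt_eqF.
have := cabs_ge0 (z - p); set y := cabs (z - p); nra.
Qed.

Lemma analytic1_lipschitz (g : Cplx R -> Cplx R) p : analytic1_at g p ->
  exists B : R, exists2 r : R, 0 < r &
    forall z, cabs (z - p) <= r ->
      cabs (g z) <= B /\ cabs (g z - g p) <= B * cabs (z - p).
Proof.
move=> [c /nbhs_cabs [e e0 h]].
have [|B [r /andP[r0 _] hr]] := @power_series_lipschitz c g p e e0.
  move=> z /h /cvgCP; apply: cvgC_ext => n.
  by rewrite /polysum /series /= big_mkord.
by exists B, r.
Qed.

End Sequences.

(** * Pringsheim's theorem for quotients *)

Section Pringsheim.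
Variable R : realType.
Implicit Types (c : nat -> R) (g : nat -> Cplx R).

Lemma cvgC_ofR (u : nat -> R) (l : R) :
  u @ \oo --> l -> cvgC (fun n => ofR (u n)) (ofR l).
Proof.
move=> /cvgrPdist_lt ul e e0; have [N _ h] := ul _ e0.
by exists N => n Nn; rewrite -ofRB cabs_ofR distrC; exact: h.
Qed.

Lemma bernoulli_ge (x : R) n : 0 <= x <= 1 -> 1 - n%:R * x <= (1 - x) ^+ n.
Proof.
move=> /andP[x0 x1]; elim: n => [|n IH]; first by rewrite expr0 mul0r subr0.
rewrite exprS -natr1.
have : (1 - x) * (1 - n%:R * x) <= (1 - x) * (1 - x) ^+ n.
  by apply: ler_wpM2l => //; lra.
have : 0 <= n%:R :> R by []. move: (n%:R : R) => y. nra.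
Qed.

Lemma cvgC_real_ge (u : nat -> R) (l : Cplx R) (N : nat) :
  (forall n, (N <= n)%N -> u N <= u n) -> cvgC (fun n => ofR (u n)) l ->
  l = ofR (complex.Re l) /\ u N <= complex.Re l.
Proof.
move=> mon ul; split.
  have h : cvgC (fun n => ofR (u n)) (ofR (complex.Re l)).
    move=> e e0; have [M hM] := ul e e0; exists M => n /hM.
    apply: le_lt_trans; rewrite -ofRB cabs_ofR.
    by have := ler_Re_cabs (ofR (u n) - l); rewrite ReD ReN.
  exact: cvgC_unique ul h.
rewrite leNgt; apply/negP => lt.
have e0 : 0 < u N - complex.Re l by lra.
have [M hM] := ul _ e0.
have := hM _ (leq_maxr N M); have := mon _ (leq_maxl N M).
have := ler_Re_cabs (ofR (u (maxn N M)) - l); rewrite ReD ReN /=.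
have := ler_norm (u (maxn N M) - complex.Re l); lra.
Qed.

Lemma cvgC_geometric_bounded (u : nat -> R) (M q : R) : 0 <= q < 1 ->
  (forall n, `|u n| <= M) -> cvgC (fun n => ofR (u n * q ^+ n)) 0.
Proof.
move=> /andP[q0 q1] uM.
have M0 : 0 <= M by apply: le_trans (uM 0%N).
have hq : cvgC (fun n => ofR (q ^+ n)) 0.
  by apply/(@cvgC_ofR _ 0)/cvg_expr; rewrite ger0_norm.
move=> e e0; have e'0 : 0 < e / (M + 1) by apply: divr_gt0 => //; lra.
have [N hN] := hq _ e'0; exists N => n /hN.
rewrite !subr0 !cabs_ofR normrM ltr_pdivlMr; last by lra.
have := uM n; have := normr_ge0 (u n); have := normr_ge0 (q ^+ n); nra.
Qed.

(** [h] holds the Taylor coefficients at [rho] of a denominator with values [Hh]. The expansion is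
    used for real t just left of [rho], and [eta <= r / 2] makes the half-radius estimates apply
    there. *)
Variables (rho eta r B : R) (h : nat -> Cplx R) (Hh : R -> Cplx R).
Hypothesis rho0 : 0 < rho.
Hypothesis eta0 : 0 < eta.
Hypothesis etarho : eta <= rho.
Hypothesis etar : eta <= r / 2.
Hypothesis r0 : 0 < r.
Hypothesis hB : forall k, cabs (h k) * r ^+ k <= B.
Hypothesis h00 : h 0%N != 0.
Hypothesis hcvg : forall t, rho - eta < t < rho ->
  cvgC (polysum h (ofR (t - rho))) (Hh t).

(** Left of [rho] the series of [c] is the quotient of the series of [g] and [h], written as a
    product to avoid dividing. This is the invariant of the repeated division by rho - t, with [D]
    measuring the numerator. *)
Let left_quotient c g (D : R) :=
  [/\ forall k, 0 <= c k, forall k, cabs (g k) * r ^+ k <= D &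
  forall t, rho - eta < t < rho -> exists A,
    cvgC (fun n => ofR (\sum_(k < n) c k * t ^+ k)) A /\
    cvgC (polysum g (ofR (t - rho))) (A * Hh t)].

(** [b] is the limit g_0 / h_0 of the quotient as t tends to [rho] from the left. It is real as a
    limit of real values, and it bounds the partial sums at [rho] because the quotient bounds those
    at t < rho. *)
Let sum_at_rho c g D : left_quotient c g D ->
  exists2 b : R, g 0%N = ofR b * h 0%N & forall N, \sum_(k < N) c k * rho ^+ k <= b.
Proof.
move=> [c0 gD hA].
have [rho_gt0 eta_gt0 eta_rho eta_r r_gt0] := And5 rho0 eta0 etarho etar r0.
have B0 : 0 <= B.
  by apply: le_trans (hB 0); rewrite expr0 mulr1 cabs_ge0.
have D0 : 0 <= D.
  by apply: le_trans (gD 0%N); rewrite expr0 mulr1 cabs_ge0.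
pose a0 := cabs (h 0%N).
have a00 : 0 < a0 by rewrite cabs_gt0.
pose q := g 0%N / h 0%N.
have gq : g 0%N = q * h 0%N by rewrite divfK.
(* Chosen so that |A - q| |Hh| <= L m at distance m from [rho]: the increments of A Hh and of Hh are
   both linear in m. The 1 makes [L] positive. *)
pose L := 2 * (D / r) + cabs q * (2 * (B / r)) + 1.
have Dr : 0 <= D / r by rewrite divr_ge0 // ltW.
have Br : 0 <= B / r by rewrite divr_ge0 // ltW.
have L0 : 0 < L.
  have : 0 <= cabs q * (2 * (B / r)) by apply: mulr_ge0; [exact: cabs_ge0|apply: mulr_ge0].
  rewrite /L; lra.
have key (e : R) (N : nat) : 0 < e ->
    `|complex.Im q| <= e /\ \sum_(k < N) c k * rho ^+ k <= complex.Re q + e.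
  move=> e0.
  pose S := \sum_(k < N) c k * rho ^+ k.
  have S0 : 0 <= S.
    by apply: sumr_ge0 => i _; rewrite mulr_ge0 // exprn_ge0 // ltW.
  (* In order: stay in the interval; keep |Hh| >= |h_0| / 2; make |A - q| <= e / 2; and, by
     Bernoulli's inequality, let the [N]-th partial sum drop by at most e / 2 between [rho] and rho
     - m. *)
  pose m := Num.min (Num.min (eta / 2) (a0 / (4 * (B / r) + 1)))
    (Num.min (e * a0 / (4 * L)) (e * rho / (2 * (N%:R * S + 1)))).
  have NS : 0 <= N%:R * S by rewrite mulr_ge0.
  have m0 : 0 < m.
    rewrite /m !lt_min; apply/andP; split; apply/andP; split; first by lra.
    - by apply: divr_gt0; lra.
    - by apply: divr_gt0; [exact: mulr_gt0|lra].
    - by apply: divr_gt0; [exact: mulr_gt0|lra].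
  have m1 : m <= eta / 2 by rewrite /m !ge_min lexx.
  have m2 : m * (4 * (B / r) + 1) <= a0.
    by rewrite -ler_pdivlMr /m ?ge_min ?lexx ?orbT //; lra.
  have m3 : m * (4 * L) <= e * a0.
    by rewrite -ler_pdivlMr /m ?ge_min ?lexx ?orbT //; lra.
  have m4 : m * (2 * (N%:R * S + 1)) <= e * rho.
    by rewrite -ler_pdivlMr /m ?ge_min ?lexx ?orbT //; lra.
  have tt : rho - eta < rho - m < rho by apply/andP; split; lra.
  have [A [cA gA]] := hA _ tt.
  have absm : cabs (ofR (rho - m - rho)) = m.
    by rewrite cabs_ofR (_ : _ - _ = - m) ?normrN ?gtr0_norm //; ring.
  have dh : cabs (Hh (rho - m) - h 0%N) <= 2 * (B / r) * cabs (ofR (rho - m - rho)).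
    by apply: polysum_dist0 (hcvg tt) => //; rewrite absm; lra.
  have dg : cabs (A * Hh (rho - m) - g 0%N) <= 2 * (D / r) * cabs (ofR (rho - m - rho)).
    by apply: polysum_dist0 gA => //; rewrite absm; lra.
  rewrite absm in dh dg.
  have Aq : cabs (A - q) <= e / 2.
    have hlow : a0 / 2 <= cabs (Hh (rho - m)).
      have := ler_cabsB (Hh (rho - m)) (Hh (rho - m) - h 0%N).
      rewrite (_ : _ - (_ - _) = h 0%N); last by ring.
      rewrite -/a0; nra.
    have : cabs ((A - q) * Hh (rho - m)) <= L * m.
      have -> : (A - q) * Hh (rho - m) =
         (A * Hh (rho - m) - g 0%N) - q * (Hh (rho - m) - h 0%N).
        by rewrite gq; ring.
      apply: le_trans (ler_cabsB _ _) _; rewrite cabsM /L.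
      have := cabs_ge0 q; nra.
    rewrite cabsM => lt.
    have := ler_wpM2l (cabs_ge0 (A - q)) hlow => lt2.
    have : cabs (A - q) * (a0 / 2) <= e / 2 * (a0 / 2) by nra.
    by rewrite ler_pM2r //; lra.
  have [] := @cvgC_real_ge _ A N _ cA.
    move=> n Nn; rewrite -!(big_mkord xpredT (fun k => c k * _ ^+ k)).
    rewrite (big_cat_nat (leq0n N) Nn) /= lerDl.
    by apply: sumr_ge0 => i _; rewrite mulr_ge0 // exprn_ge0 //; lra.
  move=> AR AS; split.
    apply: (@le_trans _ _ (cabs (A - q))); last by lra.
    apply: le_trans (ler_Im_cabs _).
    by rewrite AR ImD ImN /= add0r normrN.
  have hS : S * (1 - N%:R * (m / rho)) <= \sum_(k < N) c k * (rho - m) ^+ k.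
    rewrite /S mulr_suml; apply: ler_sum => k _.
    rewrite -mulrA; apply: ler_wpM2l => //.
    have -> : rho - m = rho * (1 - m / rho) by field; rewrite gt_eqF.
    rewrite exprMn; apply: ler_wpM2l; first by rewrite exprn_ge0 // ltW.
    have x01 : 0 <= m / rho <= 1.
      apply/andP; split; first by rewrite divr_ge0 // ltW.
      by rewrite ler_pdivrMr //; lra.
    apply: le_trans (bernoulli_ge k x01); rewrite lerD2l lerN2.
    by apply: ler_wpM2r; [case/andP: x01|rewrite ler_nat ltnW].
  have hS2 : S * (N%:R * (m / rho)) <= e / 2.
    have -> : S * (N%:R * (m / rho)) = m * (N%:R * S) / rho by ring.
    rewrite ler_pdivrMr //; nra.
  have : complex.Re A - complex.Re q <= cabs (A - q).
    by apply: le_trans (ler_Re_cabs _); rewrite ReD ReN ler_norm.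
  move: AS hS; rewrite -/S; lra.
have qR : q = ofR (complex.Re q).
  have : complex.Im q = 0.
    apply/eqP; rewrite -normr_eq0; apply/eqP/le_anti; rewrite normr_ge0 andbT.
    by apply/ler_addgt0Pr => e e0; rewrite add0r; have [] := key e 0%N e0.
  by case: (q) => x y /= ->.
exists (complex.Re q); first by rewrite -qR.
by move=> N; apply/ler_addgt0Pr => e e0; have [] := key e N e0.
Qed.

(** Coefficient of t^j in (b - A(t)) / (rho - t), where A is the series of [c]. It is nonnegative as
    soon as [b] bounds the partial sums at [rho]. *)
Let remainder c (b : R) j := (b - \sum_(k < j.+1) c k * rho ^+ k) / rho ^+ j.+1.

(** A finite telescoping identity, free of convergence and of the sign of rho - t: it carries the
    quotient over to the remainder for t < rho and compares partial sums for t > rho. *)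
Let remainder_step c b t N :
  (rho - t) * \sum_(j < N.+1) remainder c b j * t ^+ j =
  b - \sum_(j < N.+1) c j * t ^+ j - remainder c b N * t ^+ N.+1.
Proof.
elim: N => [|N IH].
  rewrite !big_ord1 /remainder big_ord1 !expr0 !mulr1 !expr1.
  by field; rewrite gt_eqF.
rewrite big_ord_recr /= mulrDr IH [in RHS]big_ord_recr /= /remainder.
rewrite [in X in _ + (rho - t) * (X / _ * _)]big_ord_recr.
rewrite [in X in _ = _ - _ - (X / _) * _]big_ord_recr /=.
set S := \sum_(k < N.+1) c k * rho ^+ k.
rewrite (exprS rho N.+1) (exprS t N.+1).
have rn0 : rho != 0 by rewrite gt_eqF.
have : rho ^+ N.+1 != 0 by rewrite expf_neq0.
move: (rho ^+ N.+1) (t ^+ N.+1) => P T P0.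
by field; rewrite rn0 P0.
Qed.

(** The constant terms of A Hh - b Hh cancel by the choice of b, so dividing by t - rho only shifts
    the coefficients. Since b <= D / |h_0|, the bound [D] grows by a fixed factor. *)
Let left_quotient_step c g D : left_quotient c g D ->
  exists b : R, [/\ b <= D / cabs (h 0%N),
    forall N, \sum_(k < N) c k * rho ^+ k <= b &
    left_quotient (remainder c b) (fun k => g k.+1 - ofR b * h k.+1)
      ((1 + B / cabs (h 0%N)) / r * D)].
Proof.
move=> lq; have [b gb cb] := sum_at_rho lq; exists b.
have [rho_gt0 eta_gt0 eta_rho eta_r r_gt0] := And5 rho0 eta0 etarho etar r0.
have [c0 gD hA] := lq.
have b0 : 0 <= b by have := cb 0%N; rewrite big_ord0.
have a00 : 0 < cabs (h 0%N) by rewrite cabs_gt0.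
have bD : b <= D / cabs (h 0%N).
  rewrite ler_pdivlMr //; apply: le_trans (gD 0%N).
  by rewrite gb cabsM cabs_ofR expr0 mulr1 ger0_norm.
have rem0 k : 0 <= remainder c b k.
  by rewrite /remainder divr_ge0 ?subr_ge0 ?exprn_ge0 // ltW.
split=> //; split=> //.
  move=> k.
  have h1 := gD k.+1; have h2 := hB k.+1.
  have -> : (1 + B / cabs (h 0%N)) / r * D = (D + D / cabs (h 0%N) * B) / r.
    by field; rewrite !gt_eqF.
  rewrite ler_pdivlMr //.
  rewrite (_ : _ * r = cabs (g k.+1 - ofR b * h k.+1) * r ^+ k.+1); last first.
    by rewrite exprSr mulrA.
  apply: (@le_trans _ _ ((cabs (g k.+1) + b * cabs (h k.+1)) * r ^+ k.+1)).
    apply: ler_wpM2r; first by rewrite exprn_ge0 // ltW.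
    by apply: le_trans (ler_cabsB _ _) _; rewrite cabsM cabs_ofR ger0_norm.
  rewrite mulrDl; apply: lerD => //; rewrite -mulrA; apply: ler_pM => //.
  by rewrite mulr_ge0 ?cabs_ge0 // exprn_ge0 // ltW.
move=> t tt; have [A [cA gA]] := hA t tt.
have [t1 t2] := andP tt.
have rt : rho - t != 0 by rewrite subr_eq0 gt_eqF.
exists ((ofR b - A) / ofR (rho - t)); split.
  apply: (cvgC_shift (k := 1)).
  (* The truncation error in [remainder_step] is thus at most b (t / rho)^(n+1) and vanishes in the
     limit. *)
  have rem_bd n : `|remainder c b n * rho ^+ n.+1| <= b.
    rewrite /remainder divfK ?expf_neq0 ?gt_eqF //.
    rewrite ger0_norm ?subr_ge0 // gerDl oppr_le0.
    by apply: sumr_ge0 => i _; rewrite mulr_ge0 // exprn_ge0 // ltW.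
  have q01 : 0 <= t / rho < 1.
    apply/andP; split; first by apply: divr_ge0; lra.
    by rewrite ltr_pdivrMr //; lra.
  have l0 := cvgC_geometric_bounded q01 rem_bd.
  have l1 := cvgCZ (ofR (t / rho)) l0; rewrite mulr0 in l1.
  have := cvgCZ (ofR (rho - t))^-1
     (cvgCB (cvgCB (cvgC_cst (ofR b)) (cvgC_shiftr 1 cA)) l1).
  rewrite subr0 [_^-1 * (_ - A)]mulrC; apply: cvgC_ext => n /=.
  rewrite addn1 -!ofRM -!ofRB -ofRV -ofRM; congr ofR.
  apply: (mulfI rt); rewrite mulVKf // remainder_step; congr (_ - _).
  rewrite expr_div_n [t ^+ n.+1]exprS (exprS rho n).
  have rn0 : rho != 0 by rewrite gt_eqF.
  have : rho ^+ n != 0 by rewrite expf_neq0.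
  move: (rho ^+ n) (t ^+ n) => P T P0.
  by field; rewrite rn0 P0.
have u0 : ofR (t - rho) != 0 by rewrite ofR_eq0 subr_eq0 lt_eqF.
have := cvgCZ (ofR (t - rho))^-1
  (cvgC_shiftr 1 (cvgCB gA (cvgCZ (ofR b) (hcvg tt)))).
have -> : (ofR (t - rho))^-1 * (A * Hh t - ofR b * Hh t) =
   (ofR b - A) / ofR (rho - t) * Hh t.
  rewrite -(opprB t rho) ofRN; move: (ofR (t - rho)) u0 => w w0; by field.
apply: cvgC_ext => n /=.
rewrite addn1 !polysumS gb.
have -> : polysum (fun k => g k.+1 - ofR b * h k.+1) (ofR (t - rho)) n =
  polysum (fun k => g k.+1) (ofR (t - rho)) n -
  ofR b * polysum (fun k => h k.+1) (ofR (t - rho)) n.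
  rewrite /polysum mulr_sumr -sumrB; apply: eq_bigr => i _; ring.
move: (ofR (t - rho)) u0 => w w0; by field.
Qed.

(** Each division contributes its value b at [rho] and leaves the remainder series with one factor
    u. As the numerator bound is multiplied by a fixed ratio each time, the contributions form a
    geometric sum. *)
Let sum_beyond c g D (u : R) N : left_quotient c g D -> 0 <= u ->
  \sum_(k < N) c k * (rho + u) ^+ k <=
  D / cabs (h 0%N) *
    \sum_(k < N) ((1 + B / cabs (h 0%N)) / r * u) ^+ k.
Proof.
move=> + u0; elim: N c g D => [|N IH] c g D lq; first by rewrite !big_ord0 mulr0.
have [b [bD cb lq']] := left_quotient_step lq.
have rho_gt0 := rho0.
have step : \sum_(k < N.+1) c k * (rho + u) ^+ k <=
    b + u * \sum_(k < N) remainder c b k * (rho + u) ^+ k.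
  case: (N) => [|m].
    rewrite big_ord0 mulr0 addr0.
    by have := cb 1%N; rewrite !big_ord1 !expr0.
  have := remainder_step c b (rho + u) m.
  have -> : rho - (rho + u) = - u by ring.
  rewrite mulNr => e; rewrite big_ord_recr /=.
  (* The identity stops one term short of the sum. Its last remainder dominates the missing term
     because the partial sum at [rho] through index m + 1 is still at most b. *)
  have : c m.+1 * (rho + u) ^+ m.+1 <= remainder c b m * (rho + u) ^+ m.+1.
    apply: ler_wpM2r; first by rewrite exprn_ge0 //; lra.
    rewrite /remainder ler_pdivlMr ?exprn_gt0 //.
    by have := cb m.+2; rewrite big_ord_recr /=; lra.
  set X := \sum_(_ < _) _ in e *. set Y := \sum_(_ < _) c _ * _ in e *.
  lra.
apply: le_trans step _.
have := IH _ _ _ lq' => IHq.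
rewrite [in leRHS]big_ord_recl expr0 mulrDr mulr1; apply: lerD => //.
apply: le_trans (ler_wpM2l u0 IHq) _.
rewrite le_eqVlt; apply/orP; left; apply/eqP.
rewrite !mulr_sumr; apply: eq_bigr => i _.
by rewrite /= /bump /= add1n exprS; ring.
Qed.

(* Pringsheim's theorem for a quotient: subtracting the value at rho and
   dividing by (rho - t) keeps the coefficients nonnegative, so the Taylor
   coefficients of A at rho are nonnegative and bound its sum beyond rho. *)
Lemma pringsheim_quotient c g D :
  (forall k, 0 <= c k) -> (forall k, cabs (g k) * r ^+ k <= D) ->
  (forall t, rho - eta < t < rho -> exists A,
    cvgC (fun n => ofR (\sum_(k < n) c k * t ^+ k)) A /\
    cvgC (polysum g (ofR (t - rho))) (A * Hh t)) ->
  exists2 u : R, 0 < u &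
    exists M : R, forall N, \sum_(k < N) c k * (rho + u) ^+ k <= M.
Proof.
move=> c0 gD hA.
have lq : left_quotient c g D by split.
pose Q := (1 + B / cabs (h 0%N)) / r.
have B0 : 0 <= B by apply: le_trans (hB 0); rewrite expr0 mulr1 cabs_ge0.
have D0 : 0 <= D by apply: le_trans (gD 0%N); rewrite expr0 mulr1 cabs_ge0.
have Q0 : 0 < Q.
  apply: divr_gt0 => //; have : 0 <= B / cabs (h 0%N) by rewrite divr_ge0 ?cabs_ge0.
  lra.
(* This makes the geometric ratio Q u equal to 1/2. *)
exists (2^-1 / Q); first by apply: divr_gt0 => //; lra.
exists (D / cabs (h 0%N) * (1 - 2^-1)^-1) => N.
apply: le_trans (sum_beyond N lq _) _; first by apply: divr_ge0; lra.
apply: ler_wpM2l; first by rewrite divr_ge0 ?cabs_ge0.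
rewrite -/Q mulrC divfK ?gt_eqF //.
by apply: geometric_le; apply/andP; split; lra.
Qed.

End Pringsheim.


(** * Coefficients at a simple pole *)

Section Parseval.
Variable R : realType.

(** X^n - 1 splits and is separable, and n distinct n-th roots of unity include a primitive one. *)
Lemma exists_primitive_root n : (0 < n)%N ->
  exists z : Cplx R, n.-primitive_root z.
Proof.
move=> n0.
have [rs ers] := closed_field_poly_normal ('X^n - 1 : {poly Cplx R}).
have lc : lead_coef ('X^n - 1 : {poly Cplx R}) = 1.
  by apply/monicP; exact: monic_Xn_sub_1.
rewrite lc scale1r in ers.
have rsu : uniq rs.
  rewrite -separable_prod_XsubC -ers; apply: separable_Xn_sub_1.
  by rewrite pnatr_eq0 -lt0n.
have rsn : size rs = n.
  have := size_prod_XsubC rs id; rewrite -ers size_Xn_sub_1 //.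
  by move=> [].
have := @has_prim_root _ n rs n0.
have -> : all n.-unity_root rs.
  apply/allP => z zrs; rewrite unity_rootE.
  have : root ('X^n - 1) z by rewrite ers root_prod_XsubC.
  by rewrite rootE !hornerE subr_eq0.
by rewrite rsn leqnn => /(_ isT rsu isT) /hasP [z _]; exists z.
Qed.

Lemma cabs_primitive_root n (w : Cplx R) : n.-primitive_root w -> cabs w = 1.
Proof.
move=> wn; have := prim_expr_order wn => /(congr1 (@cabs R)).
rewrite cabsX cabs1 => /eqP.
by rewrite pexpr_eq1 ?cabs_ge0 -?lt0n ?(prim_order_gt0 wn) // => /eqP.
Qed.

Lemma sqr_cabs (z : Cplx R) : ofR (cabs z ^+ 2) = z * z^*%C.
Proof. by rewrite ofRX -cabsE; exact: sqr_normc. Qed.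

Lemma conjcM (z w : Cplx R) : (z * w)^*%C = z^*%C * w^*%C.
Proof. exact: (rmorphM (@conjc R)). Qed.

Lemma conjcX (z : Cplx R) k : (z ^+ k)^*%C = z^*%C ^+ k.
Proof. exact: (rmorphXn (@conjc R)). Qed.

Lemma conjc_sum (I : Type) (r : seq I) (P : pred I) (F : I -> Cplx R) :
  (\sum_(i <- r | P i) F i)^*%C = \sum_(i <- r | P i) (F i)^*%C.
Proof. exact: (rmorph_sum (@conjc R)). Qed.

(** Orthogonality of the characters j -> w^(k j): for k different from l the ratio w^k / w^l is an
    n-th root of unity other than 1, and its powers sum to 0. *)
Lemma parseval n (w : Cplx R) (d : nat -> Cplx R) : n.-primitive_root w ->
  \sum_(j < n) cabs (polysum d (w ^+ j) n) ^+ 2 =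
  n%:R * \sum_(k < n) cabs (d k) ^+ 2.
Proof.
move=> wn; have n0 := prim_order_gt0 wn.
have aw := cabs_primitive_root wn.
have w0 : w != 0 by rewrite -cabs_gt0 aw.
have wc : w^*%C = w^-1.
  have := sqr_cabs w; rewrite aw expr1n ofR1 => e.
  by rewrite -[LHS](mulKf w0) -e mulr1.
have conjP j : (polysum d (w ^+ j) n)^*%C = \sum_(l < n) (d l)^*%C * w^-1 ^+ j ^+ l.
  by rewrite conjc_sum; apply: eq_bigr => l _; rewrite conjcM !conjcX wc.
apply: ofRI; rewrite ofRM ofR_sum [in RHS]ofR_sum.
transitivity (\sum_(j < n) \sum_(k < n) \sum_(l < n)
    d k * (d l)^*%C * (w ^+ k / w ^+ l) ^+ j).
  apply: eq_bigr => j _; rewrite sqr_cabs conjP /polysum big_distrlr /=.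
  apply: eq_bigr => k _; apply: eq_bigr => l _.
  rewrite exprMn !exprVn -!exprM [(k * j)%N]mulnC [(l * j)%N]mulnC.
  by rewrite [LHS]mulrACA.
rewrite exchange_big /= mulr_sumr; apply: eq_bigr => k _.
rewrite exchange_big /= (bigD1 k) //= [X in _ + X]big1 => [|l lk].
  rewrite addr0 divff ?expf_neq0 // sqr_cabs.
  under eq_bigr do rewrite expr1n mulr1.
  by rewrite sumr_const card_ord ofR_nat mulr_natl.
rewrite -mulr_sumr; set z := w ^+ k / w ^+ l.
have z1 : z - 1 != 0.
  rewrite subr_eq0; apply: contra lk => /eqP e.
  have : w ^+ k = w ^+ l by rewrite -(divfK (expf_neq0 l w0) (w ^+ k)) -/z e mul1r.
  move/eqP; rewrite (eq_prim_root_expr wn) !modn_small // => /eqP kl.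
  by apply/eqP/val_inj.
have := subrX1 z n.
rewrite expr_div_n -!exprM mulnC (mulnC l) !exprM (prim_expr_order wn) !expr1n.
rewrite divr1 subrr => /esym /eqP; rewrite mulf_eq0 (negPf z1) /= => /eqP ->.
by rewrite mulr0.
Qed.

(** Finite Parseval on the circle of radius s, after which s tends to 1. Truncating the series moves
    its value by at most 1, whence B + 1. *)
Lemma bounded_sum_coef_sqr (c : nat -> Cplx R) (B : R) :
  (forall s : R, 0 <= s < 1 -> exists M, forall n,
     \sum_(k < n) cabs (c k) * s ^+ k <= M) ->
  (forall t, cabs t < 1 -> exists2 l, cvgC (polysum c t) l & cabs l <= B) ->
  forall n, \sum_(k < n) cabs (c k) ^+ 2 <= (B + 1) ^+ 2.
Proof.
move=> cM cB.
have B0 : 0 <= B.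
  have [|l _] := cB 0; first by rewrite cabs0.
  exact/le_trans/cabs_ge0.
have inner (s : R) (m : nat) : 0 <= s < 1 ->
    \sum_(k < m) (cabs (c k) * s ^+ k) ^+ 2 <= (B + 1) ^+ 2.
  move=> s01; have [s0 s1] := andP s01.
  have [M hM] := cM s s01.
  have term0 k : 0 <= cabs (c k) * s ^+ k by rewrite mulr_ge0 ?cabs_ge0 ?exprn_ge0.
  have [N hN] := bounded_tail term0 hM ltr01.
  (* Enough terms for a tail below 1 and for all [m] coefficients in question; the 1 ensures that a
     primitive root exists. *)
  pose n := maxn 1 (maxn N m).
  have n0 : (0 < n)%N by rewrite leq_max.
  have Nn : (N <= n)%N by rewrite !leq_max leqnn orbT.
  have mn : (m <= n)%N by rewrite !leq_max leqnn !orbT.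
  apply: (@le_trans _ _ (\sum_(k < n) (cabs (c k) * s ^+ k) ^+ 2)).
    rewrite -!(big_mkord xpredT (fun k => (cabs (c k) * s ^+ k) ^+ 2)).
    rewrite (big_cat_nat (leq0n m) mn) /= lerDl.
    by apply: sumr_ge0 => i _; rewrite sqr_ge0.
  have [w wn] := exists_primitive_root n0.
  have aw := cabs_primitive_root wn.
  have := parseval (fun k => c k * ofR s ^+ k) wn.
  have bd (j : 'I_n) :
      cabs (polysum (fun k => c k * ofR s ^+ k) (w ^+ j) n) ^+ 2 <= (B + 1) ^+ 2.
    apply: lerXn2r; rewrite ?nnegrE ?cabs_ge0 //; first by lra.
    pose t := ofR s * w ^+ j.
    have at' : cabs t = s by rewrite cabsM cabsX aw expr1n mulr1 cabs_ofR ger0_norm.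
    have -> : polysum (fun k => c k * ofR s ^+ k) (w ^+ j) n = polysum c t n.
      by apply: eq_bigr => k _; rewrite exprMn mulrA.
    have [|l tl lB] := cB t; first by rewrite at'.
    have : cabs (l - polysum c t n) <= 1.
      apply: (cvgC_le (cvgCB tl (cvgC_cst _))); exists n => p np.
      apply: (@le_trans _ _ (\sum_(N <= k < p) cabs (c k) * s ^+ k)); last first.
        by apply/ltW/hN; exact: leq_trans Nn np.
      rewrite /polysum -!(big_mkord xpredT (fun k => c k * t ^+ k)).
      rewrite (big_cat_nat (leq0n n) np) /= addrAC subrr add0r.
      apply: le_trans (ler_cabs_sum _ _ _) _.
      rewrite [leRHS](big_cat_nat Nn np) /=.
      under eq_bigr do rewrite cabsM cabsX at'.
      by rewrite lerDr; apply: sumr_ge0.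
    have := ler_cabsB l (l - polysum c t n).
    rewrite opprB addrC subrK; lra.
  move=> P.
  have : n%:R * \sum_(k < n) (cabs (c k) * s ^+ k) ^+ 2 <= n%:R * (B + 1) ^+ 2.
    rewrite (_ : n%:R * \sum_(k < n) _ = \sum_(j < n)
      cabs (polysum (fun k => c k * ofR s ^+ k) (w ^+ j) n) ^+ 2); last first.
      rewrite P; congr (_ * _); apply: eq_bigr => k _.
      by rewrite cabsM cabsX cabs_ofR ger0_norm.
    apply: le_trans (ler_sum _ (fun j _ => bd j)) _.
    by rewrite sumr_const card_ord mulr_natl.
  by rewrite ler_pM2l // ltr0n.
move=> n.
pose S := \sum_(k < n) cabs (c k) ^+ 2.
have S0 : 0 <= S by apply: sumr_ge0 => i _; exact: sqr_ge0.
apply/ler_addgt0Pr => e e0; rewrite -/S.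
(* With s = 1 - x, Bernoulli's inequality shows that the weights s^(2k) reduce the sum [S] by at
   most 2 n x S <= e. *)
pose x := Num.min 1 (e / ((n * 2)%:R * S + 1)).
have nS : 0 <= (n * 2)%:R * S by rewrite mulr_ge0.
have x0 : 0 < x by rewrite lt_min ltr01 divr_gt0 //; lra.
have x1 : x <= 1 by rewrite ge_min lexx.
have xe : x * ((n * 2)%:R * S + 1) <= e.
  by rewrite -ler_pdivlMr ?ge_min ?lexx ?orbT //; lra.
have s01 : 0 <= 1 - x < 1 by apply/andP; split; lra.
have := inner _ n s01.
have : S * (1 - (n * 2)%:R * x) <= \sum_(k < n) (cabs (c k) * (1 - x) ^+ k) ^+ 2.
  rewrite /S mulr_suml; apply: ler_sum => k _.
  rewrite exprMn -exprM; apply: ler_wpM2l; first exact: sqr_ge0.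
  have x01 : 0 <= x <= 1 by apply/andP; split; lra.
  apply: le_trans (bernoulli_ge (k * 2) x01); rewrite lerD2l lerN2.
  by apply: ler_wpM2r; [lra|rewrite ler_nat leq_mul2r ltnW ?orbT].
rewrite -/S; nra.
Qed.

Lemma coef_to_0 (c : nat -> Cplx R) (B : R) :
  (forall s : R, 0 <= s < 1 -> exists M, forall n,
     \sum_(k < n) cabs (c k) * s ^+ k <= M) ->
  (forall t, cabs t < 1 -> exists2 l, cvgC (polysum c t) l & cabs l <= B) ->
  cvgC c 0.
Proof.
move=> cM cB e e0.
have [N hN] := bounded_tail (fun k => sqr_ge0 (cabs (c k)))
  (bounded_sum_coef_sqr cM cB) (exprn_gt0 2 e0).
exists N => n Nn; rewrite subr0.
have := hN n.+1 (leq_trans Nn (leqnSn n)).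
rewrite big_nat_recr //= => h.
have : 0 <= \sum_(N <= i < n) cabs (c i) ^+ 2.
  by apply: sumr_ge0 => i _; exact: sqr_ge0.
move=> h2; rewrite -(ltr_pXn2r (n := 2)) ?nnegrE ?cabs_ge0 ?ltW //.
by apply: le_lt_trans h; rewrite lerDr.
Qed.

End Parseval.

Section SimplePole.
Variable R : realType.

(** Compactness of the square with real and imaginary parts in [-1, 1], which contains the disk.
    Near a point of the circle the bound concerns only t inside the disk, the side on which a
    continuation is compared with f. *)
Lemma bounded_of_locally_bounded (phi : Cplx R -> Cplx R) :
  (forall p, cabs p <= 1 -> exists B d : R, 0 < d /\
     forall t, cabs t < 1 -> cabs (t - p) < d -> cabs (phi t) <= B) ->
  exists B : R, forall t, cabs t < 1 -> cabs (phi t) <= B.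
Proof.
move=> loc.
pose pt (q : R * R) : Cplx R := (q.1 +i* q.2)%C.
pose sq : set (R * R) := `[-1, 1] `*` `[-1, 1].
have sqc : compact sq by apply: compact_setX; exact: segment_compact.
have /compact_near_coveringP cov := sqc.
pose P (N : nat) (q : R * R) := cabs (pt q) < 1 -> cabs (phi (pt q)) <= N%:R.
have dist q q' : cabs (pt q - pt q') <= `|q.1 - q'.1| + `|q.2 - q'.2|.
  by apply: le_trans (cabs_ReIm _) _; rewrite ReD ReN ImD ImN.
have locP (q : R * R) : exists B d : R, 0 < d /\
    forall t, cabs t < 1 -> cabs (t - pt q) < d -> cabs (phi t) <= B.
  have [/loc//|q1] := leP (cabs (pt q)) 1.
  (* This ball around a corner point of the square misses the disk, so any bound holds there. *)
  exists 0, (cabs (pt q) - 1); split; first by lra.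
  move=> t t1; have := ler_cabsB t (t - pt q).
  by rewrite opprB addrC subrK; lra.
have [|N _ hN] := cov _ (\oo) P _.
  move=> q _; have [B [d [d0 hB]]] := locP q.
  pose N := Num.truncn B.
  exists (ball q (d / 2), [set n | (N.+1 <= n)%N]) => /=.
    split; first by apply: nbhsx_ballx; lra.
    by exists N.+1.
  move=> [q' n] /= [[b1 b2] Nn] q'1.
  apply: (@le_trans _ _ B).
    apply: hB => //; apply: le_lt_trans (dist _ _) _.
    move: b1 b2; rewrite -!ball_normE /= distrC [X in _ -> X < _ -> _]distrC; lra.
  apply: (@le_trans _ _ N.+1%:R); first by apply/ltW; exact: truncnS_gt.
  by rewrite ler_nat.
exists N%:R => t t1.
have := hN N (leqnn N) (complex.Re t, complex.Im t).
rewrite /P /pt /=.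
have -> : (complex.Re t +i* complex.Im t)%C = t by case: (t).
apply => //; split; rewrite /= in_itv /= -ler_norml.
  by apply/ltW; apply: le_lt_trans t1; exact: ler_Re_cabs.
by apply/ltW; apply: le_lt_trans t1; exact: ler_Im_cabs.
Qed.

Lemma cvgC_geometric (t : Cplx R) : cabs t < 1 ->
  cvgC (polysum (fun=> 1) t) (1 - t)^-1.
Proof.
move=> t1.
have t10 : 1 - t != 0.
  by apply/eqP => /(congr1 (fun z => cabs (1 - z))); rewrite subKr subr0 cabs1; lra.
have h0 : cvgC (fun n => t ^+ n) 0.
  move=> e e0.
  have q01 : 0 <= cabs t < 1 by rewrite cabs_ge0.
  have one1 (n : nat) : `|1 : R| <= 1 by rewrite normr1.
  have [N hN] := cvgC_geometric_bounded q01 one1 e0.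
  exists N => n /hN; rewrite !subr0 mul1r cabs_ofR cabsX.
  by rewrite ger0_norm // exprn_ge0 // cabs_ge0.
have := cvgCZ (1 - t)^-1 (cvgCB (cvgC_cst 1) h0).
rewrite subr0 mulr1; apply: cvgC_ext => n.
apply: (mulfI t10); rewrite mulVKf // /polysum.
under eq_bigr do rewrite mul1r.
by rewrite -(opprB t 1) mulNr -subrX1 opprB.
Qed.

Lemma polysum_abs_le (C : nat -> R) (M s : R) (t l : Cplx R) :
  (forall k, 0 <= C k) -> (forall n, \sum_(k < n) C k * s ^+ k <= M) ->
  cabs t <= s -> cvgC (polysum (fun k => ofR (C k)) t) l -> cabs l <= M.
Proof.
move=> C0 hM ts h; apply: (cvgC_le h); exists 0%N => n _.
apply: le_trans (ler_cabs_sum _ _ _) _; apply: le_trans (hM n).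
apply: ler_sum => k _; rewrite cabsM cabs_ofR ger0_norm // cabsX.
apply: ler_wpM2l => //; apply: lerXn2r => //; rewrite nnegrE ?cabs_ge0 //.
exact: le_trans (cabs_ge0 t) ts.
Qed.

Lemma real_series_bounded (C : nat -> R) (t : R) (l : Cplx R) :
  cvgC (polysum (fun k => ofR (C k)) (ofR t)) l ->
  exists B : R, forall N, \sum_(k < N) C k * t ^+ k <= B.
Proof.
move=> /cvgC_bounded [B B0 hB]; exists B => N; apply: le_trans (hB N).
have -> : polysum (fun k => ofR (C k)) (ofR t) N = ofR (\sum_(k < N) C k * t ^+ k).
  by rewrite ofR_sum; apply: eq_bigr => k _; rewrite ofRM ofRX.
by rewrite cabs_ofR ler_norm.
Qed.

(** Rescaling by x0 turns the polar part into kappa / (1 - t), all of whose coefficients equal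
    kappa, so C_k x0^k tends to kappa. Nonnegativity of C_k then gives C_k |x0|^k -> |kappa|, and
    comparing the two limits shows that x0 is positive. *)
Lemma simple_pole_coef (C : nat -> R) (f : Cplx R -> Cplx R) (x0 : Cplx R) :
  (forall k, 0 <= C k) -> x0 != 0 ->
  (forall t, cabs t < cabs x0 -> cvgC (polysum (fun k => ofR (C k)) t) (f t)) ->
  (forall t, `|t| = `|x0| -> t != x0 -> regular_at f t) ->
  simple_pole f x0 ->
  x0 = ofR (cabs x0) /\
  exists2 kappa : R, 0 < kappa & (fun k => C k * cabs x0 ^+ k) @ \oo --> kappa.
Proof.
move=> C0 x00 hf reg [h [han hx0 hpole]].
pose rho := cabs x0.
have rho0 : 0 < rho by rewrite cabs_gt0.
(* Obtained from h(x0) / (x0 t - x0) = kappa / (1 - t). *)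
pose kappa := - h x0 / x0.
have kappa0 : kappa != 0 by rewrite mulf_neq0 ?oppr_eq0 ?invr_eq0.
have bdM (s : R) : 0 <= s < rho -> exists M, forall n, \sum_(k < n) C k * s ^+ k <= M.
  move=> /andP[s0 s1].
  by apply: real_series_bounded (hf (ofR s) _); rewrite cabs_ofR ger0_norm.
pose c k := ofR (C k) * x0 ^+ k - kappa.
pose phi t := f (x0 * t) - kappa / (1 - t).
have phic t : cabs t < 1 -> cvgC (polysum c t) (phi t).
  move=> t1; have x0t : cabs (x0 * t) < cabs x0 by rewrite cabsM gtr_pMr.
  have := cvgCB (hf _ x0t) (cvgCZ kappa (cvgC_geometric t1)).
  apply: cvgC_ext => n; rewrite /polysum mulr_sumr -sumrB.
  by apply: eq_bigr => k _; rewrite /c exprMn; ring.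
have cM (s : R) : 0 <= s < 1 -> exists M, forall n, \sum_(k < n) cabs (c k) * s ^+ k <= M.
  move=> s01; have [s0 s1] := andP s01.
  have [M hM] := bdM (rho * s) ltac:(by rewrite mulr_ge0 ?gtr_pMr // ltW).
  exists (M + cabs kappa * (1 - s)^-1) => n.
  apply: (@le_trans _ _ (\sum_(k < n) (C k * (rho * s) ^+ k + cabs kappa * s ^+ k))).
    apply: ler_sum => k _; rewrite exprMn mulrA -mulrDl.
    apply: ler_wpM2r; first by rewrite exprn_ge0.
    apply: le_trans (ler_cabsB _ _) _.
    by rewrite cabsM cabs_ofR cabsX ger0_norm.
  rewrite big_split /= -mulr_sumr; apply: lerD; first exact: hM.
  by apply: ler_wpM2l; [exact: cabs_ge0|exact: geometric_le].
have phiB : exists B : R, forall t, cabs t < 1 -> cabs (phi t) <= B.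
  apply: bounded_of_locally_bounded => p p1.
  (* At the pole [phi] is a difference quotient of [h], bounded by the Lipschitz estimate; elsewhere
     f(x0 t) and kappa / (1 - t) are bounded separately. *)
  have [->|pn1] := eqVneq p 1.
    have [B [r r0 hr]] := analytic1_lipschitz han.
    have [e e0 he] := (nbhs_cabs _ _).1 hpole.
    exists B, (Num.min e r / rho); split.
      by rewrite divr_gt0 // lt_min e0.
    move=> t t1; rewrite ltr_pdivlMr // lt_min => /andP[te tr].
    have d : cabs (x0 * t - x0) = cabs (t - 1) * rho.
      by rewrite -[X in _ - X]mulr1 -mulrBr cabsM mulrC.
    have t10 : t - 1 != 0.
      by rewrite subr_eq0; apply: contraTneq t1 => ->; rewrite cabs1 ltxx.
    have -> : phi t = (h (x0 * t) - h x0) / (x0 * t - x0).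
      rewrite /phi he ?d // ?lt_norm_cabs ?cabsM ?gtr_pMr // /kappa.
      rewrite -[X in x0 * t - X]mulr1 -mulrBr -(opprB t 1).
      by field; rewrite x00 t10.
    have d0 : 0 < cabs (x0 * t - x0) by rewrite d mulr_gt0 ?cabs_gt0.
    rewrite cabsM cabsV ler_pdivrMr //.
    by apply: (hr _ _).2; rewrite d ltW.
  have [B [d [d0 fB]]] : exists B d : R, 0 < d /\ forall t, cabs t < 1 ->
      cabs (t - p) < d -> cabs (f (x0 * t)) <= B.
    have [plt|pge] := ltP (cabs p) 1.
      have p0 := cabs_ge0 p.
      have [M hM] := bdM (rho * ((1 + cabs p) / 2))
        ltac:(rewrite mulr_ge0 ?gtr_pMr //; lra).
      exists M, ((1 - cabs p) / 2); split; first by lra.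
      move=> t t1 tp.
      apply: (polysum_abs_le C0 hM); last first.
        by apply: hf; rewrite cabsM gtr_pMr.
      rewrite cabsM; apply: ler_wpM2l; first exact: ltW.
      by have := ler_cabsD (t - p) p; rewrite subrK; lra.
    have p_1 : cabs p = 1 by apply/le_anti; rewrite p1.
    have [|| g gan /nbhs_cabs [e e0 he]] := reg (x0 * p).
    - by rewrite !cabsE cabsM p_1 mulr1.
    - by rewrite -[X in _ != X]mulr1 (inj_eq (mulfI x00)).
    have [B [r r0 hr]] := analytic1_lipschitz gan.
    exists B, (Num.min e r / rho); split.
      by rewrite divr_gt0 // lt_min e0.
    move=> t t1; rewrite ltr_pdivlMr // lt_min => /andP[te tr].
    have d : cabs (x0 * t - x0 * p) = cabs (t - p) * rho.
      by rewrite -mulrBr cabsM mulrC.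
    rewrite he ?d // ?lt_norm_cabs ?cabsM ?p_1 ?mulr1 ?gtr_pMr //.
    by apply: (hr _ _).1; rewrite d ltW.
  have q0 : 0 < cabs (1 - p) by rewrite cabs_gt0 subr_eq0 eq_sym.
  exists (B + cabs kappa / (cabs (1 - p) / 2)), (Num.min d (cabs (1 - p) / 2)); split.
    by rewrite lt_min d0; lra.
  move=> t t1; rewrite lt_min => /andP[td tp].
  apply: le_trans (ler_cabsB _ _) _; apply: lerD; first exact: fB.
  rewrite cabsM cabsV; apply: ler_wpM2l; first exact: cabs_ge0.
  have := ler_cabsD (1 - t) (t - p); rewrite addrA subrK => tri.
  by rewrite lef_pV2 ?posrE; lra.
have [B hB] := phiB.
have c0 : cvgC c 0.
  apply: (@coef_to_0 _ c B) => // t t1; exists (phi t); [exact: phic|exact: hB].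
have Ck : cvgC (fun k => ofR (C k) * x0 ^+ k) kappa.
  have := cvgCD c0 (cvgC_cst kappa); rewrite add0r; apply: cvgC_ext => k.
  by rewrite /c subrK.
have absC : cvgC (fun k => ofR (C k * rho ^+ k)) (ofR (cabs kappa)).
  move=> e /Ck[N hN]; exists N => k /hN; apply: le_lt_trans.
  rewrite -ofRB cabs_ofR.
  have -> : C k * rho ^+ k = cabs (ofR (C k) * x0 ^+ k).
    by rewrite cabsM cabs_ofR cabsX ger0_norm.
  set z := ofR _ * _.
  rewrite ler_norml; have := ler_cabsD (z - kappa) kappa.
  have := ler_cabsB z (z - kappa); rewrite opprB addrC !subrK.
  move=> a b; apply/andP; split; lra.
have kk : 0 < cabs kappa by rewrite cabs_gt0.
have x0E : x0 = ofR rho.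
  pose u := x0 / ofR rho.
  have r1 : ofR rho != 0 by rewrite ofR_eq0 gt_eqF.
  have uk k : ofR (C k) * x0 ^+ k = ofR (C k * rho ^+ k) * u ^+ k.
    rewrite ofRM ofRX /u expr_div_n; field.
    by rewrite expf_neq0.
  (* C k x0^k and C k |x0|^k both have nonzero limits, and they differ by u^k. *)
  have u1 : cabs u = 1 by rewrite cabsM cabsV cabs_ofR gtr0_norm // divff ?gt_eqF.
  have e1 : cvgC (fun k => ofR (C k * rho ^+ k) * u ^+ k - ofR (cabs kappa) * u ^+ k) 0.
    move=> e /absC[N hN]; exists N => k /hN.
    by rewrite subr0 -mulrBl (cabsM _ (u ^+ k)) cabsX u1 expr1n mulr1.
  have e2 : cvgC (fun k => ofR (cabs kappa) * u ^+ k) kappa.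
    have := cvgCB Ck e1; rewrite subr0; apply: cvgC_ext => k.
    by rewrite uk; ring.
  (* Shifting the index multiplies the limit of |kappa| u^k by u; as this limit is nonzero, u =
     1. *)
  have e3 : kappa = u * kappa.
    apply: cvgC_unique (cvgC_shiftr 1 e2) _.
    apply: cvgC_ext (cvgCZ u e2) => k; rewrite addn1 exprS; ring.
  have : u = 1 by apply: (mulIf kappa0); rewrite mul1r -e3.
  by move/(congr1 (fun z => z * ofR rho)); rewrite divfK // mul1r.
split=> //; exists (cabs kappa) => //.
apply/cvgrPdist_lt => e /absC[N hN]; exists N => // k /= /hN.
by rewrite -ofRB cabs_ofR distrC.
Qed.

End SimplePole.

(** * Unconditional sums over graded index sets *)

Section FiniteSums.
Variables (R : realType) (I : choiceType).
Local Open Scope fset_scope.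
Local Open Scope ring_scope.

Lemma sum_fset_le (A B : {fset I}) (F : I -> R) : A `<=` B ->
  (forall s, 0 <= F s) -> \sum_(s <- A) F s <= \sum_(s <- B) F s.
Proof.
move=> AB F0; apply: (@le_trans _ _ (\sum_(s <- B) if s \in A then F s else 0)).
  rewrite -(big_fset_incl _ AB) => [|s _ /negPf ->//].
  by rewrite le_eqVlt [X in _ == X](eq_big_seq F) ?eqxx // => s ->.
by apply: ler_sum => s _; case: ifP.
Qed.

Lemma esum_leP (D : set I) (F : I -> R) (B : R) :
  (\esum_(s in D) (F s)%:E <= B%:E)%E <->
  forall J : {fset I}, (forall s, s \in J -> D s) -> \sum_(s <- J) F s <= B.
Proof.
split=> [h J JD|h].
  rewrite -lee_fin; apply: le_trans h; apply: esum_ge.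
  exists [set` J]; first by split=> // s /JD.
  by rewrite fsbig_finite // set_fsetK sumEFin.
apply: ge_ereal_sup => /= _ [X [finX XD] <-].
rewrite fsbig_finite // sumEFin lee_fin; apply: h => s.
by rewrite in_fset_set // inE => /XD.
Qed.

Lemma esum_ltyP (F : I -> R) : (forall s, 0 <= F s) ->
  (\esum_(s in [set: I]) (F s)%:E < +oo)%E <->
  exists B : R, forall J : {fset I}, \sum_(s <- J) F s <= B.
Proof.
move=> F0; split=> [h|[B hB]].
  exists (fine (\esum_(s in [set: I]) (F s)%:E)) => J.
  apply: (esum_leP setT F _).1 => //.
  by rewrite fineK // ge0_fin_numE // esum_ge0 // => s _; rewrite lee_fin.
apply: (@le_lt_trans _ _ B%:E); last exact: ltry.
by apply/esum_leP => J _.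
Qed.

Lemma has_sumP (u : I -> Cplx R) (l : Cplx R) :
  has_sum u l <-> forall e : R, 0 < e -> exists J0 : {fset I}, forall J : {fset I},
    J0 `<=` J -> cabs (\sum_(s <- J) u s - l) < e.
Proof.
have fil := @summability.totally_filter I.
have psE (J : {fset I}) : summability.partial_sum u J = \sum_(s <- J) u s.
  by rewrite big_seq_fsetE.
split=> [/cvgrPdist_lt h e e0|h].
  have [|J0 _ hJ0] := h (ofR e); first by rewrite -ofR0 ofR_lt.
  exists J0 => J J0J; have := hJ0 J J0J.
  by rewrite /= norm_lt_ofR cabsB psE.
apply/cvgrPdist_lt => e /gt0_ofR[e' e'0 ->].
have [J0 hJ0] := h e' e'0; exists J0 => // J J0J.
by rewrite norm_lt_ofR cabsB psE; exact: hJ0.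
Qed.

(** Finite sets disjoint from [J0] have sums of modulus at most 2. Splitting such a set by the sign
    of the real part, and again by that of the imaginary part, bounds the absolute values by 4 + 4 =
    8. *)
Lemma has_sum_bounded (u : I -> Cplx R) (l : Cplx R) : has_sum u l ->
  exists B : R, forall J : {fset I}, \sum_(s <- J) cabs (u s) <= B.
Proof.
move=> /has_sumP /(_ 1 ltr01) [J0 hJ0].
have disj (J : {fset I}) : (forall s, s \in J -> s \notin J0) ->
    cabs (\sum_(s <- J) u s) <= 2.
  move=> dJ.
  have -> : \sum_(s <- J) u s =
     (\sum_(s <- J0 `|` J) u s - l) - (\sum_(s <- J0) u s - l).
    rewrite (big_fsetID _ (fun s => s \in J0) (J0 `|` J)) /=.
    rewrite [X in X + _ - l](_ : _ = \sum_(s <- J0) u s); last first.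
      apply: eq_fbigl => s; rewrite !inE /=.
      by case: (s \in J0); rewrite ?andbF.
    rewrite [X in _ + X - l](_ : _ = \sum_(s <- J) u s); last first.
      apply: eq_fbigl => s; rewrite !inE /=.
      by have := dJ s; case: (s \in J0); case: (s \in J) => //= /(_ isT).
    by ring.
  apply: le_trans (ler_cabsB _ _) _.
  have := hJ0 _ (fsubsetUl J0 J); have := hJ0 _ (fsubset_refl J0); lra.
have part (f : Cplx R -> R) (J : {fset I}) : {morph f : x y / x + y} -> f 0 = 0 ->
    (forall z, `|f z| <= cabs z) -> (forall s, s \in J -> s \notin J0) ->
    \sum_(s <- J) `|f (u s)| <= 4.
  move=> fD f0 fle dJ.
  pose Jp := [fset s in J | 0 <= f (u s)]; pose Jn := [fset s in J | ~~ (0 <= f (u s))].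
  rewrite (big_fsetID _ (fun s => 0 <= f (u s))) /=.
  have hp : \sum_(s <- Jp) `|f (u s)| <= 2.
    rewrite (eq_big_seq (fun s => f (u s))) => [|s]; last first.
      by rewrite !inE /= => /andP[_ /ger0_norm].
    rewrite -(big_morph f fD f0).
    apply: le_trans (ler_norm _) _; apply: le_trans (fle _) _; apply: disj => s.
    by rewrite !inE /= => /andP[/dJ].
  have hn : \sum_(s <- Jn) `|f (u s)| <= 2.
    rewrite (eq_big_seq (fun s => - f (u s))) => [|s]; last first.
      by rewrite !inE /= -ltNge => /andP[_ /ltr0_norm].
    rewrite sumrN -(big_morph f fD f0).
    apply: le_trans (ler_norm _) _; rewrite normrN.
    apply: le_trans (fle _) _; apply: disj => s.
    by rewrite !inE /= => /andP[/dJ].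
  lra.
exists (\sum_(s <- J0) cabs (u s) + 8) => J.
rewrite (big_fsetID _ (fun s => s \in J0)) /=; apply: lerD.
  apply: sum_fset_le => [|s]; last exact: cabs_ge0.
  by apply/fsubsetP => s; rewrite !inE /= => /andP[].
have dJ s : s \in [fset x in J | x \notin J0] -> s \notin J0.
  by rewrite !inE /= => /andP[].
apply: (@le_trans _ _ (\sum_(s <- [fset x in J | x \notin J0])
   (`|complex.Re (u s)| + `|complex.Im (u s)|))).
  by apply: ler_sum => s _; exact: cabs_ReIm.
rewrite big_split /=.
have := part _ _ (@ReD R) erefl (@ler_Re_cabs R) dJ.
have := part _ _ (@ImD R) erefl (@ler_Im_cabs R) dJ.
lra.
Qed.

End FiniteSums.

(* The finite sets [sl k] are the level sets of the degree on the support. *)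
Section GradedSums.
Variables (R : realType) (I : choiceType) (sl : nat -> {fset I}) (deg : I -> nat).
Hypothesis deg_sl : forall k s, s \in sl k -> deg s = k.
Local Open Scope fset_scope.
Local Open Scope ring_scope.

Definition graded_support (V : zmodType) (u : I -> V) :=
  forall s, u s != 0 -> s \in sl (deg s).

Lemma sum_by_degree (V : zmodType) (u : I -> V) (J : {fset I}) P :
  graded_support u -> (forall s, s \in J -> (deg s < P)%N) ->
  \sum_(s <- J) u s = \sum_(k < P) \sum_(s <- J | s \in sl k) u s.
Proof.
move=> su JP; rewrite (exchange_big_dep xpredT) //=.
apply: eq_big_seq => s sJ.
have [->|us0] := eqVneq (u s) 0; first by rewrite big1.
rewrite (big_pred1 (Ordinal (JP s sJ))) // => k /=.
apply/idP/eqP => [/deg_sl e|->]; last exact: su.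
by apply/val_inj; rewrite /= e.
Qed.

Lemma sum_degree_full (V : zmodType) (u : I -> V) (J : {fset I}) k :
  sl k `<=` J -> \sum_(s <- J | s \in sl k) u s = \sum_(s <- sl k) u s.
Proof.
move=> sJ; rewrite big_mkcond /= -(big_fset_incl _ sJ) => [|s _ /negPf -> //].
by apply: eq_big_seq => s ->.
Qed.

Lemma sum_degree_le (F : I -> R) (J : {fset I}) k : (forall s, 0 <= F s) ->
  \sum_(s <- J | s \in sl k) F s <= \sum_(s <- sl k) F s.
Proof.
move=> F0; rewrite -(sum_degree_full F (fsubsetUr J (sl k))).
rewrite big_mkcond [leRHS]big_mkcond /=; apply: sum_fset_le (fsubsetUl _ _) _ => s.
by case: ifP.
Qed.

Lemma deg_bound (J : {fset I}) : exists P, forall s, s \in J -> (deg s < P)%N.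
Proof. by exists (\max_(s <- J) deg s).+1 => s sJ; rewrite ltnS leq_bigmax_seq. Qed.

Definition levels N : {fset I} := \bigcup_(k <- iota 0 N) sl k.

Lemma sl_levels k N : (k < N)%N -> sl k `<=` levels N.
Proof. by move=> kN; apply: bigfcup_sup => //; rewrite mem_iota. Qed.

Lemma deg_levels N s : s \in levels N -> (deg s < N)%N.
Proof. by case/bigfcupP => k; rewrite mem_iota andbT /= => kN /deg_sl ->. Qed.

Lemma sum_levels (V : zmodType) (u : I -> V) N : graded_support u ->
  \sum_(s <- levels N) u s = \sum_(k < N) \sum_(s <- sl k) u s.
Proof.
move=> su; rewrite (sum_by_degree su (@deg_levels N)).
by apply: eq_bigr => k _; apply/sum_degree_full/sl_levels.
Qed.

Lemma bounded_graded (F : I -> R) (B : R) : (forall s, 0 <= F s) -> graded_support F ->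
  (forall J : {fset I}, \sum_(s <- J) F s <= B) <->
  (forall N, \sum_(k < N) \sum_(s <- sl k) F s <= B).
Proof.
move=> F0 sF; split=> [h N|h J]; first by rewrite -sum_levels.
have [P JP] := deg_bound J; rewrite (sum_by_degree sF JP).
by apply: le_trans (h P); apply: ler_sum => k _; exact: sum_degree_le.
Qed.

(** The set [J0] united with [levels N] is far enough in the net, and its sum is the graded partial
    sum once [N] exceeds every degree in [J0]. *)
Lemma has_sum_graded (u : I -> Cplx R) (l : Cplx R) : graded_support u -> has_sum u l ->
  cvgC (fun N => \sum_(k < N) \sum_(s <- sl k) u s) l.
Proof.
move=> su /has_sumP h e e0; have [J0 hJ0] := h e e0.
have [P JP] := deg_bound J0; exists P => N PN.
have := hJ0 (J0 `|` levels N) (fsubsetUl _ _).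
rewrite (@sum_by_degree _ u _ N) // => [|s]; last first.
  by rewrite inE => /orP[/JP /leq_trans -> //|/deg_levels].
rewrite (eq_bigr (fun k : 'I_N => \sum_(s <- sl k) u s)) // => k _.
by apply: sum_degree_full; exact: fsubset_trans (sl_levels (ltn_ord k)) (fsubsetUr _ _).
Qed.

(** A finite set containing [levels M] sums to the graded partial sum up to M plus terms of degree
    at least M, and these are at most the tail of the absolute sums. *)
Lemma graded_has_sum (u : I -> Cplx R) (B : R) : graded_support u ->
  (forall N, \sum_(k < N) \sum_(s <- sl k) cabs (u s) <= B) ->
  exists l, has_sum u l.
Proof.
move=> su uB.
have scu : graded_support (fun s => cabs (u s)).
  by move=> s; rewrite cabs_eq0; exact: su.
pose v k := \sum_(s <- sl k) u s.
have vB n : \sum_(k < n) cabs (v k) <= B.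
  by apply: le_trans (uB n); apply: ler_sum => k _; exact: ler_cabs_sum.
have [l hl] := cauchyC_cvg (abs_series_cauchy vB).
exists l; apply/has_sumP => e e0; have e20 : 0 < e / 2 by lra.
have w0 k : 0 <= \sum_(s <- sl k) cabs (u s) by apply: sumr_ge0 => s _; exact: cabs_ge0.
have [N hN] := bounded_tail w0 uB e20.
have [N' hN'] := hl _ e20.
pose M := maxn N N'.
have NM : (N <= M)%N := leq_maxl _ _.
exists (levels M) => J MJ.
have [P JP] := deg_bound J.
pose Q := maxn M P.
have MQ : (M <= Q)%N := leq_maxl _ _.
have JQ s : s \in J -> (deg s < Q)%N by move=> /JP /leq_trans; apply; exact: leq_maxr.
rewrite (sum_by_degree su JQ).
pose w k := \sum_(s <- J | s \in sl k) u s.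
rewrite -/(w _) -(big_mkord xpredT w) (big_cat_nat (leq0n M) MQ) /=.
have -> : \sum_(0 <= k < M) w k = \sum_(k < M) v k.
  rewrite big_mkord; apply: eq_bigr => k _; apply: sum_degree_full.
  exact: fsubset_trans (sl_levels (ltn_ord k)) MJ.
rewrite addrAC; apply: le_lt_trans (ler_cabsD _ _) _.
have h1 := hN' M (leq_maxr _ _).
have : cabs (\sum_(M <= k < Q) w k) < e / 2; last by move: h1; rewrite /v; lra.
apply: le_lt_trans (hN Q (leq_trans NM MQ)).
apply: le_trans (ler_cabs_sum _ _ _) _.
rewrite [leRHS](big_cat_nat NM MQ) /=.
apply: (@le_trans _ _ (\sum_(M <= k < Q) \sum_(s <- sl k) cabs (u s))).
  apply: ler_sum => k _; apply: le_trans (ler_cabs_sum _ _ _) _.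
  by apply: sum_degree_le => s; exact: cabs_ge0.
by rewrite lerDr; apply: sumr_ge0.
Qed.

Lemma sum_has_sum (u : I -> Cplx R) l : has_sum u l -> summability.sum u = l.
Proof.
have fil := @summability.totally_filter I.
by move=> h; apply: cvg_lim.
Qed.

End GradedSums.

(** * Analytic functions of several variables *)

Section AnalyticTaylor.
Variables (R : realType) (d : nat).
Implicit Types (g : 'rV[Cplx R]_d -> Cplx R) (p w : 'rV[Cplx R]_d).

Definition axis (i0 : 'I_d) (k : nat) : multiindex d :=
  [ffun i => if i == i0 then k else 0%N].

Lemma axis_at i k : axis i k i = k.
Proof. by rewrite ffunE eqxx. Qed.

Lemma monomial_axis w i k : monomial w (axis i k) = w 0 i ^+ k.
Proof.
rewrite /monomial (bigD1 i) //= axis_at big1 ?mulr1 // => j /negPf ji.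
by rewrite ffunE ji expr0.
Qed.

Lemma cabs_monomial w (s : multiindex d) :
  cabs (monomial w s) = \prod_(i < d) cabs (w 0 i) ^+ s i.
Proof.
rewrite /monomial; apply: (big_ind2 (fun x y => cabs x = y)) => [|x _ y _ <- <-|i _].
- by rewrite cabs1.
- by rewrite cabsM.
- by rewrite cabsX.
Qed.

(** On a line parallel to the axis only the pure powers of coordinate i survive. The singletons
    {[axis i k]} serve as levels for the graded summation. *)
Lemma analytic_at_axis g p i : analytic_at g p ->
  exists c : nat -> Cplx R, exists2 r : R, 0 < r &
    exists2 B : R, (forall k, cabs (c k) * r ^+ k <= B) &
    forall u, cabs u <= r -> cvgC (polysum c u) (g (p + u *: 'e_i)).
Proof.
move=> [c /nbhs_rV_cabs [e e0 he]].
have line u : cabs u < e -> cvgC (polysum (fun k => c (axis i k)) u) (g (p + u *: 'e_i)).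
  move=> ue.
  have near_p j : cabs ((p + u *: 'e_i) 0 j - p 0 j) < e.
    rewrite !mxE eqxx /= addrAC subrr add0r.
    by case: eqP => _; rewrite ?mulr1 ?mulr0 ?cabs0.
  have := he _ near_p; rewrite addrAC subrr add0r => hs.
  have deg1 k s : s \in [fset axis i k]%fset -> s i = k.
    by rewrite inE => /eqP ->; rewrite axis_at.
  apply: cvgC_ext (has_sum_graded (sl := fun k => [fset axis i k]%fset)
    (deg := fun s : multiindex d => s i) deg1 _ hs) => [N|s].
    apply: eq_bigr => k _; rewrite big_seq_fset1 monomial_axis !mxE eqxx.
    by rewrite eqxx mulr1.
  apply: contraNT; rewrite inE => sk; apply/eqP.
  have [j ji sj] : exists2 j, j != i & s j != 0%N.
    apply/exists_inP; apply: contraNT sk; rewrite negb_exists_in => /forall_inP h.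
    apply/eqP/ffunP => j; rewrite ffunE; case: eqVneq => [->//|ji].
    by have := h j ji; rewrite negbK => /eqP.
  rewrite /monomial (bigD1 j) //= !mxE eqxx (negPf ji) /= mulr0 expr0n (negPf sj).
  by rewrite mul0r mulr0.
have e2 : `|e / 2| = e / 2 by rewrite ger0_norm //; lra.
have hlt : cabs (ofR (e / 2) : Cplx R) < e by rewrite cabs_ofR e2; lra.
have [B B0 hB] := term_bounded (u := fun k => c (axis i k) * ofR (e / 2) ^+ k) (line _ hlt).
exists (fun k => c (axis i k)), (e / 2); first by lra.
exists B => [k|u ue]; last by apply: line; lra.
by have := hB k; rewrite cabsM cabsX cabs_ofR e2.
Qed.

Lemma multiindex_small (s : multiindex d) :
  (\sum_(i < d) s i < 2)%N -> s = [ffun=> 0%N] \/ exists i, s = axis i 1.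
Proof.
have [/forallP s0 _|] := boolP [forall i, s i == 0%N].
  by left; apply/ffunP => i; rewrite ffunE; apply/eqP.
rewrite negb_forall => /existsP[i si]; rewrite (bigD1 i) //= => lt.
right; exists i; apply/ffunP => j; rewrite ffunE.
have si1 : s i = 1%N.
  apply/eqP; rewrite eqn_leq lt0n si andbT.
  by rewrite -ltnS; apply: leq_trans lt; rewrite ltnS leq_addr.
case: eqVneq => [->//|ji]; apply/eqP.
move: lt; rewrite si1 ltnS -[X in (_ <= X)%N]addn0 leq_add2l leqn0 (bigD1 j) //=.
by rewrite addn_eq0 => /andP[].
Qed.

(** [T] collects the multi-indices of total degree at most 1, which give the affine part. The others
    have degree |s| >= 2, where del^|s| <= (del / r)^2 r^|s|, so the absolute sum at radius r
    controls the remainder. *)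
Lemma analytic_at_taylor1 g p : analytic_at g p ->
  exists c : 'I_d -> Cplx R, exists C : R, exists2 r : R, 0 < r &
    forall (w : 'rV[Cplx R]_d) (del : R), 0 <= del <= r ->
      (forall i, cabs (w 0 i) <= del) ->
      cabs (g (p + w) - g p - \sum_i c i * w 0 i) <= C * del ^+ 2.
Proof.
move=> [c /nbhs_rV_cabs [e e0 he]].
pose r := e / 2; have r0 : 0 < r by rewrite /r; lra.
have hw w : (forall i, cabs (w 0 i) <= r) ->
    has_sum (fun s => c s * monomial w s) (g (p + w)).
  move=> wr; have := he (p + w); rewrite addrAC subrr add0r; apply=> i.
  rewrite mxE addrAC subrr add0r; apply: le_lt_trans (wr i) _; rewrite /r; lra.
have ar : cabs (ofR r : Cplx R) = r by rewrite cabs_ofR ger0_norm // ltW.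
have [B hB] : exists B : R, forall J : {fset multiindex d},
    \sum_(s <- J) cabs (c s) * r ^+ (\sum_(i < d) s i)%N <= B.
  have [|B hB] := has_sum_bounded (hw (\row_i ofR r) _).
    by move=> i; rewrite mxE ar.
  exists B => J; apply: le_trans (hB J); rewrite le_eqVlt; apply/orP; left.
  apply/eqP/eq_bigr => s _; rewrite cabsM cabs_monomial; congr (_ * _).
  rewrite (big_morph (fun k => r ^+ k) (exprD r) (expr0 r)).
  by apply: eq_bigr => i _; rewrite mxE ar.
have B0 : 0 <= B.
  apply: le_trans (hB fset0); apply: sumr_ge0 => s _.
  by rewrite mulr_ge0 ?cabs_ge0 // exprn_ge0 // ltW.
pose T : {fset multiindex d} := ([ffun=> 0%N] |` [fset axis i 1 | i in 'I_d])%fset.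
have key w (del : R) : 0 <= del <= r -> (forall i, cabs (w 0 i) <= del) ->
    cabs (g (p + w) - c [ffun=> 0%N] - \sum_i c (axis i 1) * w 0 i)
      <= B / r ^+ 2 * del ^+ 2.
  move=> /andP[d0 dr] wd.
  have /has_sumP hs := hw w (fun i => le_trans (wd i) dr).
  apply/ler_addgt0Pr => x x0; have [J0 hJ0] := hs x x0.
  pose J := (J0 `|` T)%fset.
  have := hJ0 J (fsubsetUl _ _).
  have TJ : (T `<=` J)%fset := fsubsetUr _ _.
  rewrite (big_fsetID _ (fun s => s \in T) J) /=.
  rewrite [X in cabs (X + _ - _)](_ : _ = c [ffun=> 0%N] + \sum_i c (axis i 1) * w 0 i); last first.
    transitivity (\sum_(s <- T) c s * monomial w s).
      apply: eq_fbigl => s; rewrite !inE /=.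
      by case: (s == _); case: (s \in [fset _ | _ in _]%fset); rewrite ?orbT ?andbF.
    rewrite big_fsetU1 /=; last first.
      apply/imfsetP => -[i _ /ffunP /(_ i)]; by rewrite axis_at ffunE.
    rewrite /monomial big1 => [|i _]; last by rewrite ffunE expr0.
    rewrite mulr1; congr (_ + _).
    rewrite big_imfset /= => [|i j _ _ /ffunP /(_ i)]; last first.
      by rewrite axis_at ffunE; case: eqP => // ->.
    rewrite big_enum /=; apply: eq_bigr => i _.
    by rewrite -/(monomial w (axis i 1)) monomial_axis expr1.
  set J' := [fset x in J | x \notin T]%fset.
  set P := \sum_i _; set S := \sum_(s <- J') _ => hlt.
  have : cabs S <= B / r ^+ 2 * del ^+ 2.
    apply: le_trans (ler_cabs_sum _ _ _) _.
    rewrite mulrAC ler_pdivlMr ?exprn_gt0 // mulr_suml.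
    apply: (@le_trans _ _ (\sum_(s <- J')
       cabs (c s) * r ^+ (\sum_(i < d) s i)%N * del ^+ 2)); last first.
      by rewrite -mulr_suml; apply: ler_wpM2r => //; rewrite exprn_ge0.
    rewrite big_seq [leRHS]big_seq; apply: ler_sum => s.
    rewrite !inE /= => /andP[_ sT].
    have s2 : (2 <= \sum_(i < d) s i)%N.
      rewrite leqNgt; apply: contra sT => /multiindex_small [->|[i ->]].
        by rewrite eqxx.
      by apply/orP; right; apply/imfsetP; exists i.
    rewrite cabsM -!mulrA; apply: ler_wpM2l; first exact: cabs_ge0.
    apply: (@le_trans _ _ (del ^+ (\sum_(i < d) s i)%N * r ^+ 2)).
      apply: ler_wpM2r; first by rewrite exprn_ge0 // ltW.
      rewrite cabs_monomial (big_morph (fun k => del ^+ k) (exprD del) (expr0 del)).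
      apply: ler_prod => i _; rewrite exprn_ge0 ?cabs_ge0 //=.
      by apply: lerXn2r; rewrite ?nnegrE ?cabs_ge0.
    rewrite -(subnK s2); move: (_ - _)%N => m; rewrite !exprD.
    have : del ^+ m <= r ^+ m by apply: lerXn2r; rewrite ?nnegrE // ltW.
    rewrite -(mulrA (del ^+ m)) -(mulrA (r ^+ m)) (mulrC (r ^+ 2)) => h.
    by apply: ler_wpM2r => //; rewrite mulr_ge0 // exprn_ge0 // ltW.
  have := ler_cabsB S (c [ffun=> 0%N] + P + S - g (p + w)).
  have -> : S - (c [ffun=> 0%N] + P + S - g (p + w)) =
    g (p + w) - c [ffun=> 0%N] - P by ring.
  lra.
have gp : g p = c [ffun=> 0%N].
  have := key 0 0; rewrite lexx addr0 expr0n mulr0 big1 => [|i _]; last first.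
    by rewrite mxE mulr0.
  rewrite ltW // subr0 => /(_ isT) h.
  apply/eqP; rewrite -subr_eq0 -cabs_eq0; apply/eqP/le_anti.
  by rewrite cabs_ge0 andbT h // => i; rewrite mxE cabs0.
exists (fun i => c (axis i 1)), (B / r ^+ 2), r => // w del hd wd.
by rewrite gp; exact: key.
Qed.

(** Identifies the coefficients of the first-order expansion with the derivatives in [log_gradient]:
    the difference quotient differs from c_i by at most C |t|. *)
Lemma derive_axis g p (c : 'I_d -> Cplx R) (C r : R) i : 0 < r ->
  (forall (w : 'rV[Cplx R]_d) (del : R), 0 <= del <= r ->
      (forall i, cabs (w 0 i) <= del) ->
      cabs (g (p + w) - g p - \sum_i c i * w 0 i) <= C * del ^+ 2) ->
  'D_('e_i) g p = c i.
Proof.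
move=> r0 h; apply: cvg_lim => //.
apply/cvgrPdist_lt => _ /gt0_ofR[e e0 ->].
have C0 : 0 <= C.
  have : 0 <= C * r ^+ 2.
    apply: le_trans (cabs_ge0 _) (h 0 r _ _); first by rewrite lexx ltW.
    by move=> j; rewrite mxE cabs0 ltW.
  by rewrite pmulr_lge0 // exprn_gt0.
apply/nbhs_cabs; exists (Num.min r (e / (C + 1))).
  by rewrite lt_min r0 divr_gt0 //; lra.
move=> t; rewrite subr0 lt_min ltr_pdivlMr; last by lra.
move=> /andP[tr te] t0; rewrite norm_lt_ofR.
have at0 : 0 < cabs t by rewrite cabs_gt0.
have := h (t *: 'e_i) (cabs t).
rewrite cabs_ge0 ltW //= => /(_ isT).
have -> : \sum_j c j * (t *: 'e_i : 'rV[Cplx R]_d) 0 j = c i * t.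
  rewrite (bigD1 i) //= big1 => [|j /negPf ji]; rewrite !mxE eqxx /=.
    by rewrite eqxx mulr1 addr0.
  by rewrite ji !mulr0.
move=> /(_ _) hb.
have {}hb : cabs (g (p + t *: 'e_i) - g p - c i * t) <= C * cabs t ^+ 2.
  apply: hb => j; rewrite !mxE eqxx /=.
  by case: eqP => _; rewrite ?mulr1 ?mulr0 ?cabs0 // cabs_ge0.
have -> : c i - t^-1 *: (g (t *: 'e_i + p) - g p) =
   - (t^-1 * (g (p + t *: 'e_i) - g p - c i * t)).
  rewrite [t *: _ + p]addrC /GRing.scale /=; field.
  by rewrite -cabs_gt0.
rewrite cabsN cabsM cabsV mulrC ltr_pdivrMr //.
apply: le_lt_trans hb _; nra.
Qed.

End AnalyticTaylor.

(** * Exponentially tilted slices *)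

Section Slices.
Variables (R : realType) (n M : nat) (a : multiindex n.+1 -> R).
Hypothesis a_ge0 : forall s, 0 <= a s.
Hypothesis a_supp : forall s, a s != 0 -> forall i, (s i <= M * s ord_max)%N.
Implicit Types (z : 'rV[Cplx R]_n.+1) (s : multiindex n.+1).

(** The box of exponents at most M k contains, by [a_supp], every index with last exponent k and
    nonzero coefficient; it may also contain indices whose coefficient vanishes. *)
Definition slice (k : nat) : {fset multiindex n.+1} :=
  [fset s in [seq [ffun i => g i : nat] : multiindex n.+1 |
     g : {ffun 'I_n.+1 -> 'I_(M * k).+1} <- enum {: {ffun 'I_n.+1 -> 'I_(M * k).+1}}] | s ord_max == k]%fset.

Definition last_exponent s : nat := s ord_max.

Lemma mem_slice k s :
  (s \in slice k) = (s ord_max == k) && [forall i, (s i <= M * k)%N].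
Proof.
rewrite !inE /= andbC; case: eqP => //= sk.
apply/mapP/forallP => [[g _ ->] i|h]; first by rewrite ffunE -ltnS ltn_ord.
have h' i : (s i < (M * k).+1)%N by rewrite ltnS.
exists [ffun i => Ordinal (h' i)]; first by rewrite mem_enum.
by apply/ffunP => i; rewrite !ffunE.
Qed.

Lemma last_exponent_slice k s : s \in slice k -> last_exponent s = k.
Proof. by rewrite mem_slice => /andP[/eqP]. Qed.

Lemma graded_slice (V : zmodType) (u : multiindex n.+1 -> V) :
  (forall s, a s = 0 -> u s = 0) -> graded_support slice last_exponent u.
Proof.
move=> ua s us; rewrite mem_slice eqxx /=; apply/forallP => i.
by apply: a_supp; apply: contraNneq us => /ua ->.
Qed.

Definition term_weight z s : R := a s * \prod_(i < n.+1) cabs (z 0 i) ^+ s i.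

Lemma cabs_psterm z s : cabs (psterm a z s) = term_weight z s.
Proof. by rewrite cabsM cabs_ofR ger0_norm // cabs_monomial. Qed.

Lemma graded_psterm z : graded_support slice last_exponent (psterm a z).
Proof. by apply: graded_slice => s as0; rewrite /psterm as0 mul0r. Qed.

Lemma term_weight_ge0 z s : 0 <= term_weight z s.
Proof. by rewrite -cabs_psterm cabs_ge0. Qed.

Lemma abs_convergentP z : abs_convergent a z <->
  exists B : R, forall N, \sum_(k < N) \sum_(s <- slice k) term_weight z s <= B.
Proof.
have gw : graded_support slice last_exponent (term_weight z).
  by apply: graded_slice => s as0; rewrite /term_weight as0 mul0r.
rewrite /abs_convergent; under eq_esum do rewrite cabs_psterm.
apply: iff_trans (esum_ltyP (term_weight_ge0 z)) _.
split=> -[B hB]; exists B; apply/(bounded_graded last_exponent_slice B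
  (term_weight_ge0 z) gw); exact: hB.
Qed.

Lemma psum_cvg z : abs_convergent a z ->
  cvgC (fun N => \sum_(k < N) \sum_(s <- slice k) psterm a z s) (psum a z).
Proof.
move=> /abs_convergentP[B hB].
have [|l hl] := graded_has_sum last_exponent_slice (graded_psterm (z := z)) (B := B).
  move=> N; under eq_bigr do under eq_bigr do rewrite cabs_psterm.
  exact: hB.
rewrite /psum (sum_has_sum hl).
exact: (has_sum_graded last_exponent_slice (graded_psterm (z := z)) hl).
Qed.

Definition slice_sum k : R := \sum_(s <- slice k) a s.

Lemma slice_sum_ge0 k : 0 <= slice_sum k.
Proof. by apply: sumr_ge0. Qed.

Lemma slice_total_sum k : slice_total a k = slice_sum k.
Proof.
rewrite /slice_total (_ : (\esum_(s in _) _)%E = (slice_sum k)%:E) //.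
apply/le_anti/andP; split.
  apply/esum_leP => J Jk.
  apply: le_trans (sum_degree_le slice J k a_ge0).
  rewrite [leRHS]big_mkcond /= big_seq [leRHS]big_seq; apply: ler_sum => s sJ.
  case: ifPn => // sk.
  have [->//|as0] := eqVneq (a s) 0; move: sk; rewrite mem_slice (Jk s sJ) eqxx /=.
  by case/negP; apply/forallP => i; rewrite -(Jk s sJ); exact: a_supp.
apply: esum_ge; exists [set` slice k].
  by split=> // s /=; rewrite mem_slice => /andP[/eqP].
by rewrite fsbig_finite // set_fsetK sumEFin.
Qed.

Lemma sum_psterm_ones (t : Cplx R) k :
  \sum_(s <- slice k) psterm a (ones_last n t) s = ofR (slice_sum k) * t ^+ k.
Proof.
rewrite /slice_sum ofR_sum mulr_suml big_seq [RHS]big_seq.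
apply: eq_bigr => s; rewrite mem_slice => /andP[/eqP sk _].
rewrite /psterm /monomial (bigD1 ord_max) //= mxE eqxx sk big1 ?mulr1 // => i /negPf im.
by rewrite mxE im expr1n.
Qed.

Lemma psum_ones (t : Cplx R) : abs_convergent a (ones_last n t) ->
  cvgC (polysum (fun k => ofR (slice_sum k)) t) (psum a (ones_last n t)).
Proof.
move=> /psum_cvg; apply: cvgC_ext => N.
by apply: eq_bigr => k _; rewrite sum_psterm_ones.
Qed.

Section Tilt.
Variable j : 'I_n.

Definition tilted_point (l : R) (t : Cplx R) : 'rV[Cplx R]_n.+1 :=
  \row_i (if i == ord_max then t
          else if i == lift ord_max j then ofR (expR l) else 1).

(** Coefficient of t^k in F(1, .., e^l, .., 1, t), that is, C_k times the moment generating function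
    of s_j under mu_k. *)
Definition tilted_sum (l : R) k : R :=
  \sum_(s <- slice k) a s * expR (l * (s (lift ord_max j))%:R).

(** For t >= 0 the terms are nonnegative, so boundedness of the partial sums is convergence. *)
Definition tilted_bounded (l t : R) :=
  exists B : R, forall N, \sum_(k < N) tilted_sum l k * t ^+ k <= B.

Lemma lift_max_neq : (lift ord_max j == ord_max) = false.
Proof. by rewrite eq_sym (negPf (neq_lift _ _)). Qed.

Lemma tilted_point_last l t : tilted_point l t 0 ord_max = t.
Proof. by rewrite mxE eqxx. Qed.

Lemma tilted_point_lift l t : tilted_point l t 0 (lift ord_max j) = ofR (expR l).
Proof. by rewrite mxE lift_max_neq eqxx. Qed.

Lemma tilted_point_other l t i : i != ord_max -> i != lift ord_max j ->
  tilted_point l t 0 i = 1.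
Proof. by move=> /negPf i1 /negPf i2; rewrite mxE i1 i2. Qed.

Lemma tilted_point0 t : tilted_point 0 t = ones_last n t.
Proof. by apply/rowP => i; rewrite !mxE expR0; case: ifP => // _; case: ifP. Qed.

Lemma tilted_pointD l (t u : Cplx R) :
  tilted_point l t + u *: 'e_ord_max = tilted_point l (t + u).
Proof.
apply/rowP => i; rewrite !mxE eqxx /=; case: eqP => _; rewrite ?mulr1 //.
by rewrite mulr0 addr0.
Qed.

Lemma tilted_sum_ge0 l k : 0 <= tilted_sum l k.
Proof. by apply: sumr_ge0 => s _; rewrite mulr_ge0 ?expR_ge0. Qed.

Lemma prod_tilted (l t : R) s : 
  \prod_(i < n.+1) (tilted_point l (ofR t) 0 i) ^+ s i =
  ofR (expR (l * (s (lift ord_max j))%:R) * t ^+ s ord_max).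
Proof.
rewrite (bigD1 ord_max) //= (bigD1 (lift ord_max j)) ?lift_max_neq //=.
rewrite tilted_point_last tilted_point_lift big1 => [|i /andP[i1 i2]]; last first.
  by rewrite tilted_point_other // expr1n.
by rewrite mulr1 mulrC mulrC -!ofRX -ofRM -expRM_natr mulrC.
Qed.

Lemma sum_psterm_tilted (l t : R) k :
  \sum_(s <- slice k) psterm a (tilted_point l (ofR t)) s =
  ofR (tilted_sum l k * t ^+ k).
Proof.
rewrite /tilted_sum mulr_suml ofR_sum big_seq [RHS]big_seq.
apply: eq_bigr => s; rewrite mem_slice => /andP[/eqP sk _].
by rewrite /psterm /monomial prod_tilted -ofRM sk mulrA.
Qed.

Lemma term_weight_tilted (l t : R) s : 0 <= t ->
  term_weight (tilted_point l (ofR t)) s =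
  a s * expR (l * (s (lift ord_max j))%:R) * t ^+ s ord_max.
Proof.
move=> t0; rewrite -cabs_psterm /psterm /monomial prod_tilted -ofRM cabs_ofR.
by rewrite mulrA ger0_norm // mulr_ge0 ?exprn_ge0 // mulr_ge0 ?expR_ge0.
Qed.

(** By convexity (1 + x)^D lies below its chord over [0, 1]. *)
Lemma pow_linear_bound (x : R) D : 0 <= x <= 1 -> (1 + x) ^+ D <= 1 + (2 ^+ D - 1) * x.
Proof.
move=> /andP[x0 x1]; elim: D => [|D IH]; first by rewrite !expr0; lra.
rewrite !exprS; have : 1 <= 2 ^+ D :> R by rewrite exprn_ege1 //; lra.
move: IH; set P := (1 + x) ^+ D; set Q := 2 ^+ D => IH Q1.
have : (1 + x) * P <= (1 + x) * (1 + (Q - 1) * x) by apply: ler_wpM2l => //; lra.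
have : (Q - 1) * (x * x) <= (Q - 1) * x by apply: ler_wpM2l; [lra|nra].
nra.
Qed.

(** The domain of convergence is an interior, so all coordinates must be free to move. An index of
    slice k has total degree at most D k, so a relative change x of each coordinate costs a factor
    (1 + x)^(D k), absorbed by the margin between t and t'. *)
Lemma tilted_domain (l t t' : R) : 0 < t -> t < t' -> tilted_bounded l t' ->
  convergence_domain a (tilted_point l (ofR t)).
Proof.
move=> t0 tt' [B hB].
pose D := (n.+1 * M)%N.
pose x := Num.min 1 ((t' / t - 1) / 2 ^+ D).
have P0 : 0 < 2 ^+ D :> R by apply: exprn_gt0.
have q1 : 1 < t' / t by rewrite ltr_pdivlMr // mul1r.
have x0 : 0 < x by rewrite lt_min ltr01 divr_gt0 //; lra.
have x1 : x <= 1 by rewrite ge_min lexx.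
have xP : 2 ^+ D * x <= t' / t - 1.
  by rewrite mulrC -ler_pdivlMr // ge_min lexx orbT.
have powD : t * (1 + x) ^+ D <= t'.
  have : (1 + x) ^+ D <= t' / t.
    apply: le_trans (pow_linear_bound D _) _; first by rewrite (ltW x0).
    lra.
  by rewrite ler_pdivlMr // mulrC.
pose p := tilted_point l (ofR t).
(* The least modulus of a coordinate, so that an absolute change below x m is a relative change
   below x. *)
pose m := Num.min (Num.min t 1) (expR l).
have m0 : 0 < m by rewrite !lt_min t0 ltr01 expR_gt0.
have pm i : m <= cabs (p 0 i).
  rewrite mxE; case: ifP => _; first by rewrite cabs_ofR gtr0_norm // !ge_min lexx.
  case: ifP => _; last by rewrite cabs1 !ge_min lexx orbT.
  by rewrite cabs_ofR gtr0_norm ?expR_gt0 // !ge_min lexx !orbT.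
apply/nbhs_rV_cabs; exists (x * m); first exact: mulr_gt0.
move=> z zp; apply/abs_convergentP; exists B => N; apply: le_trans (hB N).
apply: ler_sum => k _; rewrite /tilted_sum mulr_suml big_seq [leRHS]big_seq.
apply: ler_sum => s; rewrite mem_slice => /andP[/eqP sk /forallP sM].
rewrite /term_weight -mulrA; apply: ler_wpM2l => //.
apply: (@le_trans _ _ (\prod_(i < n.+1) ((1 + x) * cabs (p 0 i)) ^+ s i)).
  apply: ler_prod => i _; rewrite exprn_ge0 ?cabs_ge0 //=.
  apply: lerXn2r; rewrite ?nnegrE ?cabs_ge0 //.
    by rewrite mulr_ge0 ?cabs_ge0 //; lra.
  have := ler_cabsD (z 0 i - p 0 i) (p 0 i); rewrite subrK.
  have := zp i; have := pm i; nra.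
under eq_bigr do rewrite exprMn.
rewrite big_split /= -cabs_monomial /monomial prod_tilted cabs_ofR.
rewrite ger0_norm; last by rewrite mulr_ge0 ?expR_ge0 // exprn_ge0 // ltW.
rewrite -(big_morph (fun e => (1 + x) ^+ e) (exprD (1 + x)) (expr0 (1 + x))).
rewrite mulrCA; apply: ler_wpM2l; first exact: expR_ge0.
rewrite sk -sk.
apply: (@le_trans _ _ (((1 + x) ^+ D) ^+ s ord_max * t ^+ s ord_max)).
  apply: ler_wpM2r; first by rewrite exprn_ge0 // ltW.
  rewrite -exprM; apply: ler_weXn2l; first by lra.
  apply: (@leq_trans (\sum_(i < n.+1) M * k)); first exact: leq_sum.
  by rewrite sum_nat_const card_ord sk mulnA.
rewrite -exprMn mulrC; apply: lerXn2r; rewrite ?nnegrE //.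
  by rewrite mulr_ge0 ?exprn_ge0 ?ltW //; lra.
by lra.
Qed.

Lemma tilted_psum (l t : R) : 0 <= t -> tilted_bounded l t ->
  cvgC (fun N => ofR (\sum_(k < N) tilted_sum l k * t ^+ k))
    (psum a (tilted_point l (ofR t))).
Proof.
move=> t0 [B hB].
have /psum_cvg : abs_convergent a (tilted_point l (ofR t)).
  apply/abs_convergentP; exists B => N; apply: le_trans (hB N).
  rewrite le_eqVlt; apply/orP; left; apply/eqP; apply: eq_bigr => k _.
  rewrite /tilted_sum mulr_suml big_seq [RHS]big_seq; apply: eq_bigr => s.
  by rewrite mem_slice => /andP[/eqP sk _]; rewrite term_weight_tilted // sk.
apply: cvgC_ext => N; rewrite ofR_sum; apply: eq_bigr => k _.
exact: sum_psterm_tilted.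
Qed.

(** Along the last coordinate G and H become Taylor series at [rho] in one variable, and [psum]
    becomes the series of [tilted_sum]. If H were nonzero at [rho], [pringsheim_quotient] would
    bound the partial sums at some rho + u. *)
Lemma denominator_root (U : set 'rV[Cplx R]_n.+1) (G H : 'rV[Cplx R]_n.+1 -> Cplx R)
  (l rho : R) : 0 < rho ->
  (forall t, 0 < t < rho -> tilted_bounded l t) ->
  (forall t, rho < t -> ~ tilted_bounded l t) ->
  open U -> U (tilted_point l (ofR rho)) ->
  analytic_on U G -> analytic_on U H ->
  (forall z, U z -> convergence_domain a z -> H z != 0 -> psum a z = G z / H z) ->
  H (tilted_point l (ofR rho)) = 0.
Proof.
move=> rho0 bd nbd Uo Up Gan Han GH; apply/eqP; apply: contraT => Hp.
set p := tilted_point l (ofR rho) in Up Hp.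
have [h [rh rh0 [Bh hB hcv]]] := analytic_at_axis ord_max (Han p Up).
have [g [rg rg0 [Bg gB gcv]]] := analytic_at_axis ord_max (Gan p Up).
have /nbhs_rV_cabs[e e0 he] : \forall z \near p, U z by exact: open_nbhs_nbhs.
pose r := Num.min rh rg.
have r0 : 0 < r by rewrite lt_min rh0.
have shrink (c : nat -> Cplx R) (r' B : R) : r <= r' -> 0 < r' ->
    (forall k, cabs (c k) * r' ^+ k <= B) -> forall k, cabs (c k) * r ^+ k <= B.
  move=> rr' r'0 cB k; apply: le_trans (cB k); apply: ler_wpM2l; first exact: cabs_ge0.
  by apply: lerXn2r => //; rewrite nnegrE ltW.
have hB' := shrink h rh Bh ltac:(by rewrite ge_min lexx) rh0 hB.
have gB' := shrink g rg Bg ltac:(by rewrite ge_min lexx orbT) rg0 gB.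
have h0 : H p = h 0%N.
  have := hcv 0; rewrite scale0r addr0 cabs0 => /(_ (ltW rh0)) /cvgC_unique; apply.
  apply: (cvgC_shift (k := 1)); apply: cvgC_ext (cvgC_cst _) => N.
  by rewrite addn1 polysumS mul0r addr0.
have Bh0 : 0 <= Bh.
  by apply: le_trans (hB 0%N); rewrite expr0 mulr1 cabs_ge0.
have Br : 0 <= Bh / r by rewrite divr_ge0 // ltW.
have hp0 : 0 < cabs (h 0%N) by rewrite cabs_gt0 -h0.
(* In order: keep t positive; stay within half the radius; stay in [U]; keep H away from 0, as it
   varies by at most 2 (Bh / r) |t - rho|. *)
pose eta := Num.min (Num.min rho (r / 2))
   (Num.min e (cabs (h 0%N) / (2 * (Bh / r) + 1))).
have eta0 : 0 < eta.
  rewrite !lt_min rho0 e0 /=; apply/andP; split; first by lra.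
  by apply: divr_gt0 => //; lra.
have eta1 : eta <= rho by rewrite !ge_min lexx.
have eta2 : eta <= r / 2 by rewrite !ge_min lexx orbT.
have eta3 : eta <= e by rewrite !ge_min lexx !orbT.
have eta4 : eta * (2 * (Bh / r) + 1) <= cabs (h 0%N).
  by rewrite -ler_pdivlMr ?ge_min ?lexx ?orbT //; lra.
have rle : r <= rh /\ r <= rg by rewrite !ge_min !lexx orbT.
have abst t : rho - eta < t < rho -> cabs (ofR (t - rho)) < eta.
  move=> /andP[t1 t2]; rewrite cabs_ofR ltr0_norm; lra.
have ptE t : tilted_point l (ofR t) = p + ofR (t - rho) *: 'e_ord_max.
  by rewrite tilted_pointD -ofRD addrC subrK.
have hcvg t : rho - eta < t < rho ->
    cvgC (polysum h (ofR (t - rho))) (H (tilted_point l (ofR t))).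
  by move=> /abst ht; rewrite ptE; apply: hcv; lra.
have [||u u0 [B hu]] := @pringsheim_quotient R rho eta r Bh h _ rho0 eta0 eta1 eta2 r0
    hB' _ hcvg (tilted_sum l) g Bg (tilted_sum_ge0 l) gB'.
- by rewrite -h0.
- move=> t tt; have ht := abst t tt; have [t1 t2] := andP tt.
  have t0 : 0 < t by lra.
  have bt : tilted_bounded l t by apply: bd; rewrite t0.
  exists (psum a (tilted_point l (ofR t))); split.
    by apply: tilted_psum => //; exact: ltW.
  have Ht : H (tilted_point l (ofR t)) != 0.
    have d : cabs (H (tilted_point l (ofR t)) - h 0%N) <=
        2 * (Bh / r) * cabs (ofR (t - rho)).
      by apply: polysum_dist0 (hcvg t tt) => //; lra.
    apply: contraTneq d => ->; rewrite sub0r cabsN -ltNge.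
    have := cabs_ge0 (ofR (t - rho)); nra.
  rewrite (GH (tilted_point l (ofR t))) ?divfK //.
  + by rewrite ptE; apply: gcv; lra.
  + apply: he => i; rewrite ptE !mxE eqxx /= addrAC subrr add0r.
    by case: (i == ord_max); rewrite ?mulr1 ?mulr0 ?cabs0 //; lra.
  (* [tilted_domain] asks for boundedness at an argument strictly beyond t. *)
  + have [t3 t31 t32] : exists2 t3, t < t3 & t3 < rho.
      by exists ((t + rho) / 2); lra.
    by apply: (tilted_domain t0 t31); apply: bd; rewrite t32 andbT (lt_trans t0 t31).
- by case: (nbd (rho + u)); [lra|exists B].
Qed.

End Tilt.
End Slices.

(** * Second-order bounds for the exponential *)

Section Exponential.
Variable R : realType.

(** The lower bound is 1 + y <= e^y. The same inequality at -y gives e^y (1 - y) <= 1, hence the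
    upper bound. *)
Lemma expR_bounds (y : R) : `|y| <= 2^-1 -> 0 <= expR y - 1 - y <= 2 * y ^+ 2.
Proof.
rewrite ler_norml => /andP[y1 y2].
have h1 := expR_ge1Dx y; have h2 := expR_ge1Dx (- y).
have e0 := expR_gt0 y.
have : expR y * (1 - y) <= 1.
  have := ler_wpM2l (ltW e0) h2; by rewrite -expRD subrr expR0.
move=> h3; apply/andP; split; first by lra.
have : expR y * (1 - y) <= (1 + y + 2 * y ^+ 2) * (1 - y).
  have : 0 <= y ^+ 2 * (1 - 2 * y) by apply: mulr_ge0; [exact: sqr_ge0|lra].
  nra.
rewrite ler_pM2r; lra.
Qed.

Lemma expR_sub1_le (y : R) : `|y| <= 2^-1 -> `|expR y - 1| <= 2 * `|y|.
Proof.
move=> hy; have /andP[h1 h2] := expR_bounds hy.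
have : y ^+ 2 = `|y| * `|y| by rewrite -normrM -expr2 ger0_norm // sqr_ge0.
have := normr_ge0 y; have := ler_norm y; have := ler_norm (- y); rewrite normrN.
move: hy => a b c d e.
have : 2 * y ^+ 2 <= `|y| by nra.
move=> f; rewrite ler_norml; apply/andP; split; lra.
Qed.

End Exponential.

(** * First-order expansion of the tilted radius of convergence *)

Section TiltedRadius.
Variables (R : realType) (n M : nat) (a : multiindex n.+1 -> R).
Hypothesis a_ge0 : forall s, 0 <= a s.
Hypothesis a_supp : forall s, a s != 0 -> forall i, (s i <= M * s ord_max)%N.
Variables (rho0 kappa : R).
Hypothesis rho0_gt0 : 0 < rho0.
Hypothesis kappa_gt0 : 0 < kappa.
Hypothesis slice_bounded : forall t : R, 0 <= t < rho0 ->
  exists B : R, forall N, \sum_(k < N) slice_sum M a k * t ^+ k <= B.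
Hypothesis slice_cvg : (fun k => slice_sum M a k * rho0 ^+ k) @ \oo --> kappa.
Variable j : 'I_n.

Let tilted_exponent (l : R) k (s : multiindex n.+1) : s \in slice n M k ->
  `|l * (s (lift ord_max j))%:R| <= `|l| * M%:R * k%:R.
Proof.
rewrite mem_slice => /andP[_ /forallP sM].
rewrite normrM normr_nat -mulrA; apply: ler_wpM2l => //.
by rewrite -natrM ler_nat.
Qed.

(** In slice k the exponent s_j is at most M k, so tilting by l changes each weight by a factor
    between e^(-|l| M k) and e^(|l| M k). *)
Lemma tilted_sum_le (l : R) k :
  tilted_sum M a j l k <= slice_sum M a k * expR (`|l| * M%:R) ^+ k.
Proof.
rewrite /slice_sum mulr_suml /tilted_sum big_seq [leRHS]big_seq.
apply: ler_sum => s sk; apply: ler_wpM2l => //.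
rewrite -expRM_natr ler_expR.
by have := tilted_exponent l sk; rewrite ler_norml => /andP[].
Qed.

Lemma tilted_sum_ge (l : R) k :
  slice_sum M a k <= tilted_sum M a j l k * expR (`|l| * M%:R) ^+ k.
Proof.
rewrite /tilted_sum mulr_suml /slice_sum big_seq [leRHS]big_seq.
apply: ler_sum => s sk; rewrite -mulrA -[leLHS]mulr1; apply: ler_wpM2l => //.
rewrite -expRM_natr -expRD -[leLHS]expR0 ler_expR.
by have := tilted_exponent l sk; rewrite ler_norml => /andP[]; lra.
Qed.

Definition tilted_radius (l rho : R) :=
  (forall t, 0 < t < rho -> tilted_bounded M a j l t) /\
  (forall t, rho < t -> ~ tilted_bounded M a j l t).

(** With E = e^(|l| M), the tilted series at t is dominated by the slice series at t E, which gives
    the lower bound. Conversely its terms at rho0 E dominate C_k rho0^k, which does not tend to 0.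
    At l = 0 the bounds coincide and the radius is [rho0]. *)
Lemma tilted_radius_exists (l : R) : exists rho, tilted_radius l rho /\
  rho0 * expR (- (`|l| * M%:R)) <= rho <= rho0 * expR (`|l| * M%:R).
Proof.
pose E := expR (`|l| * M%:R).
have E0 : 0 < E := expR_gt0 _.
have rho0_pos := rho0_gt0.
have lower t : 0 <= t -> t * E < rho0 -> tilted_bounded M a j l t.
  move=> t0 tE; have [|B hB] := slice_bounded (t := t * E).
    by rewrite mulr_ge0 // ltW.
  exists B => N; apply: le_trans (hB N); apply: ler_sum => k _.
  rewrite exprMn [t ^+ k * _]mulrC mulrA; apply: ler_wpM2r; first by rewrite exprn_ge0.
  exact: tilted_sum_le.
have upper t : tilted_bounded M a j l t -> 0 <= t -> t <= rho0 * E.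
  move=> [B hB] t0; rewrite leNgt; apply/negP => lt.
  (* Beyond rho0 * E the terms stay above kappa / 2, so the sums are unbounded. *)
  move/cvgrPdist_lt: slice_cvg => /(_ (kappa / 2) ltac:(by rewrite divr_gt0)) [N _ hN].
  have termge k : (N <= k)%N -> kappa / 2 <= tilted_sum M a j l k * t ^+ k.
    move=> /hN /= h; apply: (@le_trans _ _ (slice_sum M a k * rho0 ^+ k)).
      by have := ler_norm (kappa - slice_sum M a k * rho0 ^+ k); lra.
    apply: (@le_trans _ _ (tilted_sum M a j l k * (rho0 * E) ^+ k)).
      rewrite exprMn [rho0 ^+ k * _]mulrC mulrA; apply: ler_wpM2r.
        by rewrite exprn_ge0 // ltW.
      exact: tilted_sum_ge.
    apply: ler_wpM2l; first exact: tilted_sum_ge0.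
    by apply: lerXn2r; rewrite ?nnegrE // ?mulr_ge0 // ltW.
  have [m hm] : exists m : nat, B < m%:R * (kappa / 2).
    exists (Num.truncn (B / (kappa / 2))).+1.
    by rewrite -ltr_pdivrMr ?divr_gt0 // truncnS_gt.
  have := hB (N + m)%N.
  rewrite -(big_mkord xpredT (fun k => tilted_sum M a j l k * t ^+ k)).
  rewrite (big_cat_nat (leq0n N) (leq_addr m N)) /=.
  have : 0 <= \sum_(0 <= k < N) tilted_sum M a j l k * t ^+ k.
    by apply: sumr_ge0 => k _; rewrite mulr_ge0 ?exprn_ge0 // tilted_sum_ge0.
  have : m%:R * (kappa / 2) <= \sum_(N <= k < N + m) tilted_sum M a j l k * t ^+ k.
    rewrite -[m in leLHS](addKn N) mulr_natl -sumr_const_nat.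
    rewrite big_nat_cond [leRHS]big_nat_cond; apply: ler_sum => k.
    by rewrite andbT => /andP[Nk _]; exact: termge.
  move: hm; set S1 := \sum_(0 <= _ < _) _; set S2 := \sum_(N <= _ < _) _; lra.
pose S := [set t : R | 0 <= t /\ tilted_bounded M a j l t].
have S0 : S 0 by split=> //; apply: lower; rewrite ?mul0r.
have supS : has_sup S.
  by split; [exists 0|exists (rho0 * E) => t [t0 bt]; exact: upper].
have ubS : forall t, S t -> t <= sup S by move=> t St; apply: ub_le_sup => //; case: supS.
exists (sup S); split; first split.
- move=> t /andP[t0 tS].
  have [t' [t'0 [B hB]] tt'] : exists2 t', S t' & t < t'.
    have e0 : 0 < sup S - t by lra.
    by have [t' St' h] := sup_adherent e0 supS; exists t' => //; lra.
  exists B => N; apply: le_trans (hB N); apply: ler_sum => k _.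
  apply: ler_wpM2l; first exact: tilted_sum_ge0.
  by apply: lerXn2r; rewrite ?nnegrE // ltW.
- move=> t St bt.
  have t0 : 0 <= t by have := ubS 0 S0; lra.
  by have := ubS t (conj t0 bt); lra.
apply/andP; split; last first.
  by apply: ge_sup; [case: supS|move=> t [t0 bt]; exact: upper].
rewrite expRN -/E leNgt; apply/negP => lt.
(* A point of [S] strictly above its supremum. *)
pose t := (sup S + rho0 / E) / 2.
have s0 := ubS 0 S0.
have : S t.
  rewrite /t; split; first by lra.
  apply: lower; first by lra.
  by rewrite -ltr_pdivlMr //; lra.
move/ubS; rewrite /t; lra.
Qed.

Variables (U : set 'rV[Cplx R]_n.+1) (G H : 'rV[Cplx R]_n.+1 -> Cplx R).
Hypothesis U_open : open U.
Hypothesis U_x : U (ones_last n (ofR rho0)).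
Hypothesis G_an : analytic_on U G.
Hypothesis H_an : analytic_on U H.
Hypothesis GH : forall z, U z -> convergence_domain a z -> H z != 0 ->
  psum a z = G z / H z.
Variables (c : 'I_n.+1 -> Cplx R) (C r : R).
Hypothesis r_gt0 : 0 < r.
Hypothesis H_taylor : forall (w : 'rV[Cplx R]_n.+1) (del : R), 0 <= del <= r ->
  (forall i, cabs (w 0 i) <= del) ->
  cabs (H (ones_last n (ofR rho0) + w) - H (ones_last n (ofR rho0))
    - \sum_i c i * w 0 i) <= C * del ^+ 2.

(** H vanishes both at x and at the tilted point, which are O(|l|) apart, so only the linear part of
    Taylor's formula remains, up to C (L l)^2. Replacing e^l - 1 by l costs at most 2 |c_j| l^2
    more. *)
Lemma radius_first_order : exists C' : R, exists2 l0 : R, 0 < l0 &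
  forall l, `|l| <= l0 -> exists rho, [/\ tilted_radius l rho, 0 < rho &
    cabs (c (lift ord_max j) * ofR l + c ord_max * ofR (rho - rho0)) <= C' * l ^+ 2].
Proof.
have rho0_pos := rho0_gt0; have r_pos := r_gt0.
have root l rho : 0 < rho -> tilted_radius l rho -> U (tilted_point j l (ofR rho)) ->
    H (tilted_point j l (ofR rho)) = 0.
  move=> p [h1 h2] Up.
  exact: (@denominator_root R n M a a_ge0 a_supp j U G H l rho p h1 h2 U_open Up
    G_an H_an GH).
(* This is the case l = 0, where the radius is exactly [rho0]. *)
have Hx : H (ones_last n (ofR rho0)) = 0.
  have [rho [hr]] := tilted_radius_exists 0.
  rewrite normr0 mul0r oppr0 expR0 mulr1 => /le_anti e.
  by rewrite -(tilted_point0 j) root ?tilted_point0 // e.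
have /nbhs_rV_cabs[e e0 he] : \forall z \near ones_last n (ofR rho0), U z.
  exact: open_nbhs_nbhs.
(* Coordinate j moves by at most 2 |l| and the last one by at most 2 rho0 M |l|. *)
pose L := 2 + 2 * rho0 * M%:R.
have M0 : 0 <= M%:R :> R by [].
have rM0 : 0 <= rho0 * M%:R by rewrite mulr_ge0 // ltW.
have L0 : 0 < L by rewrite /L -mulrA; lra.
(* In order: |l| and |l| M are at most 1/2, for the exponential bounds; L |l| <= r, for Taylor's
   formula; L |l| <= e / 2, to stay in [U]. *)
pose l0 := Num.min (2 * (M%:R + 1))^-1 (Num.min (r / L) (e / (2 * L))).
exists (C * L ^+ 2 + 2 * cabs (c (lift ord_max j))), l0.
  rewrite !lt_min invr_gt0; apply/andP; split; first by lra.
  by apply/andP; split; apply: divr_gt0 => //; lra.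
move=> l; rewrite !le_min => /and3P[l1 l2 l3].
have a0 := normr_ge0 l.
have l1' : `|l| * (2 * (M%:R + 1)) <= 1.
  by rewrite -ler_pdivlMr ?div1r //; lra.
have lM0 : 0 <= `|l| * M%:R by rewrite mulr_ge0.
rewrite ler_pdivlMr // in l2.
rewrite ler_pdivlMr in l3; last by lra.
have lh : `|l| <= 2^-1 by nra.
have lMh : `|(`|l| * M%:R)| <= 2^-1 by rewrite ger0_norm //; nra.
have lMh' : `|- (`|l| * M%:R)| <= 2^-1 by rewrite normrN.
have [rho [hr /andP[r1 r2]]] := tilted_radius_exists l.
exists rho; have rho_pos : 0 < rho.
  by apply: lt_le_trans r1; rewrite mulr_gt0 ?expR_gt0.
split=> //.
have drho : `|rho - rho0| <= 2 * rho0 * M%:R * `|l|.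
  have := expR_sub1_le lMh; have := expR_sub1_le lMh'.
  rewrite normrN (ger0_norm lM0) !ler_norml => /andP[h1 _] /andP[_ h2].
  have h3 := ler_wpM2l (ltW rho0_pos) h1; have h4 := ler_wpM2l (ltW rho0_pos) h2.
  move: h3 h4 r1 r2; set E1 := expR _; set E2 := expR _ => h3 h4 r1 r2.
  by apply/andP; split; lra.
have dexp := expR_sub1_le lh.
pose w := tilted_point j l (ofR rho) - ones_last n (ofR rho0).
have w_max : w 0 ord_max = ofR (rho - rho0) by rewrite !mxE eqxx ofRB.
have w_j : w 0 (lift ord_max j) = ofR (expR l - 1).
  by rewrite !mxE lift_max_neq eqxx ofRB.
have w_o i : i != ord_max -> i != lift ord_max j -> w 0 i = 0.
  by move=> /negPf i1 /negPf i2; rewrite !mxE i1 i2 subrr.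
have wL i : cabs (w 0 i) <= L * `|l|.
  have [->|i1] := eqVneq i ord_max; first by rewrite w_max cabs_ofR /L; lra.
  have [->|i2] := eqVneq i (lift ord_max j).
    by rewrite w_j cabs_ofR /L; nra.
  by rewrite w_o // cabs0 mulr_ge0 // ltW.
have xw : ones_last n (ofR rho0) + w = tilted_point j l (ofR rho).
  by rewrite /w addrC subrK.
have := H_taylor (w := w) (del := L * `|l|).
rewrite xw Hx root //; last first.
  apply: he => i; have := wL i; rewrite !mxE; lra.
rewrite subr0 sub0r cabsN (bigD1 ord_max) //= (bigD1 (lift ord_max j)) ?lift_max_neq //=.
rewrite big1 ?addr0 => [|i /andP[i1 i2]]; last by rewrite w_o // mulr0.
rewrite w_max w_j exprMn -normrX (ger0_norm (sqr_ge0 l)) => /(_ _ wL) h.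
have {}h := h ltac:(by rewrite mulr_ge0 //=; lra).
have -> : c (lift ord_max j) * ofR l + c ord_max * ofR (rho - rho0) =
  (c ord_max * ofR (rho - rho0) + c (lift ord_max j) * ofR (expR l - 1))
  - c (lift ord_max j) * ofR (expR l - 1 - l).
  rewrite [ofR (_ - l)]ofRB; ring.
apply: le_trans (ler_cabsB _ _) _; rewrite mulrDl; apply: lerD; first by rewrite -mulrA.
rewrite cabsM cabs_ofR -mulrA mulrCA; apply: ler_wpM2l; first exact: cabs_ge0.
by have /andP[p1 p2] := expR_bounds lh; rewrite ger0_norm.
Qed.

Lemma quadratic_bound_zero (x D l0 : R) : 0 < l0 -> 0 <= x ->
  (forall l, 0 < l <= l0 -> x * l <= D * l ^+ 2) -> x = 0.
Proof.
move=> l00 x0 h; apply/le_anti; rewrite x0 andbT.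
apply/ler_addgt0Pr => e e0; rewrite add0r.
have D0 : 0 < `|D| + 1 by have := normr_ge0 D; lra.
pose l := Num.min l0 (e / (`|D| + 1)).
have lp : 0 < l by rewrite lt_min l00 divr_gt0.
have := h l; rewrite lp ge_min lexx => /(_ isT).
rewrite expr2 mulrA ler_pM2r // => xl; apply: le_trans xl _.
have : l * (`|D| + 1) <= e by rewrite -ler_pdivlMr // ge_min lexx orbT.
have := ler_norm D; nra.
Qed.

(** The first-order relation then reads |c_j| |l| <= C' l^2 for all small l. *)
Lemma last_derivative_eq0 : c ord_max = 0 -> c (lift ord_max j) = 0.
Proof.
move=> c0; have [C' [l0 l00 h]] := radius_first_order.
apply/eqP; rewrite -cabs_eq0; apply/eqP.
apply: (quadratic_bound_zero (D := C') l00 (cabs_ge0 _)) => l /andP[lp ll].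
have [|rho [_ _]] := h l; first by rewrite gtr0_norm.
by rewrite c0 mul0r addr0 cabsM cabs_ofR gtr0_norm.
Qed.

(** [m] is c_j / (rho0 c_d), a priori complex. As l and the radius are real, its imaginary part
    times l is O(l^2), so it vanishes. *)
Lemma radius_slope : c ord_max != 0 -> exists m : R,
  c (lift ord_max j) = ofR (rho0 * m) * c ord_max /\
  exists2 D : R, 0 <= D & exists2 l0 : R, 0 < l0 &
    forall l, `|l| <= l0 -> exists rho, [/\ tilted_radius l rho, 0 < rho &
      `|rho / rho0 - 1 + m * l| <= D * l ^+ 2].
Proof.
move=> c0; have [C' [l0 l00 h]] := radius_first_order.
have rho0_pos := rho0_gt0.
have r0n : ofR rho0 != 0 by rewrite ofR_eq0 gt_eqF.
pose q := c (lift ord_max j) / (ofR rho0 * c ord_max).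
pose D := `|C'| / (rho0 * cabs (c ord_max)).
have d0 : 0 < rho0 * cabs (c ord_max) by rewrite mulr_gt0 // cabs_gt0.
have D0 : 0 <= D by rewrite divr_ge0 // ltW.
have hq l : `|l| <= l0 -> exists rho, [/\ tilted_radius l rho, 0 < rho &
    cabs (q * ofR l + ofR (rho / rho0 - 1)) <= D * l ^+ 2].
  move=> /h [rho [hr rp hc]]; exists rho; split=> //.
  have e : c (lift ord_max j) * ofR l + c ord_max * ofR (rho - rho0) =
      (q * ofR l + ofR (rho / rho0 - 1)) * (ofR rho0 * c ord_max).
    rewrite /q !ofRB ofRM ofRV; move: (ofR rho0) (ofR rho) (ofR l) r0n => x y z xn.
    by rewrite ofR1; field; rewrite xn c0.
  rewrite e in hc; move: hc; rewrite cabsM [cabs (ofR rho0 * _)]cabsM cabs_ofR gtr0_norm // => {}hc.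
  have -> : D * l ^+ 2 = `|C'| * l ^+ 2 / (rho0 * cabs (c ord_max)).
    by rewrite /D mulrAC.
  rewrite ler_pdivlMr //; apply: le_trans hc _.
  by apply: ler_wpM2r; [exact: sqr_ge0|exact: ler_norm].
have Imq : complex.Im q = 0.
  apply/eqP; rewrite -normr_eq0; apply/eqP.
  apply: (quadratic_bound_zero (D := D) l00 (normr_ge0 _)) => l /andP[lp ll].
  have [|rho [_ _ hl]] := hq l; first by rewrite gtr0_norm.
  apply: le_trans hl; apply: le_trans (ler_Im_cabs _).
  by rewrite ImD [q * _]mulrC ImZ /= addr0 normrM (gtr0_norm lp) mulrC.
have qR : q = ofR (complex.Re q) by move: Imq; case: (q) => x y /= ->.
exists (complex.Re q); split.
  rewrite ofRM -qR /q; move: (ofR rho0) r0n => x xn.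
  by field; rewrite xn c0.
exists D => //; exists l0 => // l /hq[rho [hr rp hl]]; exists rho; split=> //.
move: hl; rewrite qR -ofRM -ofRD cabs_ofR /=.
by rewrite addrC.
Qed.

End TiltedRadius.

(** * Concentration of the slice distributions *)

Section Concentration.
Variables (R : realType) (n M : nat) (a : multiindex n.+1 -> R).
Hypothesis a_ge0 : forall s, 0 <= a s.
Variable j : 'I_n.

Definition deviates (m d : R) k (s : multiindex n.+1) :=
  d < `|(s (lift ord_max j))%:R / k%:R - m|.

(** Markov's inequality for e^(l s_j): on P it is at least e^(x k), while the single term of index k
    of the tilted series is at most B. *)
Lemma chernoff (l t x B : R) k (P : pred (multiindex n.+1)) : 0 <= t ->
  (forall N, \sum_(k < N) tilted_sum M a j l k * t ^+ k <= B) ->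
  (forall s, s \in slice n M k -> P s -> x * k%:R <= l * (s (lift ord_max j))%:R) ->
  (\sum_(s <- slice n M k | P s) a s) * (t * expR x) ^+ k <= B.
Proof.
move=> t0 hB hP.
have ts0 i : 0 <= tilted_sum M a j l i * t ^+ i.
  by rewrite mulr_ge0 ?exprn_ge0 // tilted_sum_ge0.
apply: (@le_trans _ _ (tilted_sum M a j l k * t ^+ k)); last first.
  apply: le_trans (hB k.+1); rewrite big_ord_recr /= lerDr.
  by apply: sumr_ge0 => i _; exact: ts0.
rewrite exprMn [t ^+ k * _]mulrC mulrA; apply: ler_wpM2r; first by rewrite exprn_ge0.
rewrite mulr_suml big_mkcond /= /tilted_sum big_seq [leRHS]big_seq.
apply: ler_sum => s sk; case: ifP => Ps; last by rewrite mulr_ge0 ?expR_ge0.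
by apply: ler_wpM2l => //; rewrite -expRM_natr ler_expR; exact: hP.
Qed.

Variables (rho0 kappa m : R).
Hypothesis rho0_gt0 : 0 < rho0.
Hypothesis kappa_gt0 : 0 < kappa.
Hypothesis slice_cvg : (fun k => slice_sum M a k * rho0 ^+ k) @ \oo --> kappa.
Variables (D l0 : R).
Hypothesis D_ge0 : 0 <= D.
Hypothesis l0_gt0 : 0 < l0.
Hypothesis slope : forall l, `|l| <= l0 -> exists rho,
  [/\ tilted_radius M a j l rho, 0 < rho & `|rho / rho0 - 1 + m * l| <= D * l ^+ 2].

(* The tilt by a small l of either sign beats the deviation: since
   rho(l) / rho0 = 1 - m l + O(l^2), some t < rho(l) exceeds
   rho0 e^(- m l - |l| d). *)
Lemma good_tilt (d : R) : 0 < d -> exists2 l : R, 0 < l &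
  forall l', `|l'| = l -> exists t B : R, [/\ 0 < t,
    forall N, \sum_(k < N) tilted_sum M a j l' k * t ^+ k <= B &
    rho0 < t * expR (m * l' + d * l)].
Proof.
move=> d0; have [rho0_pos D0 l00] := And3 rho0_gt0 D_ge0 l0_gt0.
pose Q := `|m| + d.
have m0 := normr_ge0 m.
have Q0 : 0 < Q by rewrite /Q; lra.
have Q2 : 0 <= Q ^+ 2 by exact: sqr_ge0.
(* In order: the expansion of the radius holds; |y| <= l Q <= 1/2, for [expR_bounds]; the quadratic
   errors D l^2 and 2 Q^2 l^2 together stay below the gain d l. *)
pose l := Num.min l0 (Num.min (2^-1 / Q) (d / (2 * (D + 2 * Q ^+ 2 + 1)))).
have lp : 0 < l.
  rewrite !lt_min l00; apply/andP; split=> //; apply/andP; split.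
    by apply: divr_gt0 => //; lra.
  by apply: divr_gt0 => //; lra.
have l1 : l <= l0 by rewrite ge_min lexx.
have l2 : l * Q <= 2^-1 by rewrite -ler_pdivlMr // !ge_min lexx !orbT.
have l3 : l * (2 * (D + 2 * Q ^+ 2 + 1)) <= d.
  by rewrite -ler_pdivlMr ?ge_min ?lexx ?orbT //; lra.
exists l => // l' l'l.
have [|rho [[bd _] rp hr]] := slope (l := l'); first by rewrite l'l.
pose y := - (m * l' + d * l).
have yQ : `|y| <= l * Q.
  rewrite normrN; apply: le_trans (ler_normD _ _) _.
  by rewrite !normrM l'l (gtr0_norm d0) (gtr0_norm lp) /Q; lra.
have yh : `|y| <= 2^-1 by lra.
have /andP[_ ey] := expR_bounds yh.
have y2 : y ^+ 2 <= l ^+ 2 * Q ^+ 2.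
  by rewrite -exprMn -(real_normK (num_real y)) lerXn2r ?nnegrE // mulr_ge0 // ltW.
have ll : l' ^+ 2 = l ^+ 2 by rewrite -l'l real_normK // num_real.
have key : rho0 * expR y < rho.
  rewrite -ltr_pdivlMl // mulrC.
  move: hr; rewrite ll ler_norml => /andP[hr _].
  have : l * (2 * (D + 2 * Q ^+ 2 + 1)) * l <= d * l by apply: ler_wpM2r => //; exact: ltW.
  move: hr ey y2; rewrite /y; set E := expR _; set q := rho / rho0.
  rewrite !expr2; set yy := (- _) * (- _); nra.
(* Midway: below rho, so that the partial sums are bounded, yet above rho0 e^y. *)
pose t := (rho0 * expR y + rho) / 2.
have e0 := expR_gt0 y.
have t0 : 0 < t by rewrite /t; nra.
have [B hB] : tilted_bounded M a j l' t by apply: bd; rewrite t0 /t /=; lra.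
exists t, B; split=> //.
have -> : m * l' + d * l = - y by rewrite opprK.
rewrite expRN ltr_pdivlMr // /t; lra.
Qed.

(** The tilts l and -l bound the upper and lower tails by B1 / v1^k and B2 / v2^k with v1, v2 >
    rho0, whereas C_k eventually exceeds kappa / (2 rho0^k). Both quotients decay geometrically. *)
Lemma slice_concentration (d : R) : 0 < d ->
  (fun k => (\sum_(s <- slice n M k | deviates m d k s) a s) / slice_sum M a k)
    @ \oo --> (0 : R).
Proof.
move=> d0; have [rho0_pos kappa_pos] := conj rho0_gt0 kappa_gt0.
have [l lp hl] := good_tilt d0.
have [|t1 [B1 [t10 hB1 r1]]] := hl l; first by rewrite gtr0_norm.
have [|t2 [B2 [t20 hB2 r2]]] := hl (- l); first by rewrite normrN gtr0_norm.
pose v1 := t1 * expR (m * l + d * l); pose v2 := t2 * expR (m * - l + d * l).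
have v10 : 0 < v1 by rewrite mulr_gt0 ?expR_gt0.
have v20 : 0 < v2 by rewrite mulr_gt0 ?expR_gt0.
pose f k : R := 2 / kappa * (B1 * (rho0 / v1) ^+ k + B2 * (rho0 / v2) ^+ k).
have f0 : f @ \oo --> (0 : R).
  have g (v : R) : 0 < v -> rho0 < v -> (fun k => (rho0 / v) ^+ k) @ \oo --> (0 : R).
    move=> v0 rv; apply: cvg_expr.
    by rewrite ger0_norm ?divr_ge0 ?ltW // ltr_pdivrMr // mul1r.
  rewrite (_ : 0 = 2 / kappa * (B1 * 0 + B2 * 0)); last by rewrite !mulr0 addr0 mulr0.
  apply: cvgM; first exact: cvg_cst.
  by apply: cvgD; apply: cvgM; [exact: cvg_cst|exact: g|exact: cvg_cst|exact: g].
have S0 k : 0 <= \sum_(s <- slice n M k | deviates m d k s) a s by exact: sumr_ge0.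
apply: (squeeze_cvgr _ (@cvg_cst _ (0 : R) _ _ _) f0).
move/cvgrPdist_lt: slice_cvg => /(_ (kappa / 2) ltac:(by rewrite divr_gt0)) [N _ hN].
(* The 1 excludes k = 0, where s_j / k takes the default value 0. *)
exists (maxn N 1) => // k /=; rewrite geq_max => /andP[/hN /= hk k0].
have Ck : kappa / 2 < slice_sum M a k * rho0 ^+ k.
  by have := ler_norm (kappa - slice_sum M a k * rho0 ^+ k); lra.
have rk : 0 < rho0 ^+ k by rewrite exprn_gt0.
have C0 : 0 < slice_sum M a k.
  have : 0 < slice_sum M a k * rho0 ^+ k by lra.
  by rewrite pmulr_lgt0.
apply/andP; split; first by rewrite divr_ge0 // ltW.
have kR : 0 < k%:R :> R by rewrite ltr0n.
have h1 := chernoff (P := fun s => m + d < (s (lift ord_max j))%:R / k%:R)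
  (x := m * l + d * l) (k := k) (ltW t10) hB1.
have h2 := chernoff (P := fun s => (s (lift ord_max j))%:R / k%:R < m - d)
  (x := m * - l + d * l) (k := k) (ltW t20) hB2.
set S := \sum_(s <- _ | _) _.
have SS : S <= B1 / v1 ^+ k + B2 / v2 ^+ k.
  apply: (@le_trans _ _
    (\sum_(s <- slice n M k | m + d < (s (lift ord_max j))%:R / k%:R) a s +
     \sum_(s <- slice n M k | (s (lift ord_max j))%:R / k%:R < m - d) a s)).
    rewrite /S big_mkcond [X in _ <= X + _]big_mkcond [X in _ <= _ + X]big_mkcond.
    rewrite /= -big_split /=; apply: ler_sum => s _; rewrite /deviates.
    have := a_ge0 s; set x := _ / _ => as0.
    rewrite ltNge ler_norml negb_and -!ltNge.
    have -> : (x - m < - d) = (x < m - d) by apply/idP/idP; lra.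
    have -> : (d < x - m) = (m + d < x) by apply/idP/idP; lra.
    by case: (x < _) => /=; case: (_ < x); lra.
  apply: lerD; rewrite ler_pdivlMr ?exprn_gt0 //.
    apply: h1 => s _; rewrite ltr_pdivlMr // => h; nra.
  apply: h2 => s _; rewrite ltr_pdivrMr // => h; nra.
rewrite ler_pdivrMr // /f; apply: (le_trans SS).
rewrite !expr_div_n.
have -> : 2 / kappa * (B1 * (rho0 ^+ k / v1 ^+ k) + B2 * (rho0 ^+ k / v2 ^+ k)) *
   slice_sum M a k = (B1 / v1 ^+ k + B2 / v2 ^+ k) *
   (2 / kappa * (slice_sum M a k * rho0 ^+ k)) by ring.
rewrite -[leLHS]mulr1; apply: ler_wpM2l; first exact: le_trans (S0 k) SS.
by rewrite mulrAC ler_pdivlMr // mul1r; lra.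
Qed.

End Concentration.

(** * Reduction of the theorem to single coordinates *)

Lemma compact_ratio_bound (R : realType) (n : nat) (K : set 'rV[R]_n.+1)
    (a : multiindex n.+1 -> R) :
  compact K -> (forall s, ~ ratio_in K s -> a s = 0) ->
  exists M : nat, forall s, a s != 0 -> forall i, (s i <= M * s ord_max)%N.
Proof.
move=> /compact_bounded [B [_ hB]] aK.
(* Every number above [B] bounds the norm on [K], hence so does B + 1. If the last exponent is 0,
   [ratio_in] leaves only s = 0, for which any [M] will do. *)
pose M := (Num.truncn (B + 1)).+1.
exists M => s as0 i.
have : ratio_in K s by apply: contrapT => /aK e; rewrite e eqxx in as0.
rewrite /ratio_in; case: eqP => [_ ->|/eqP s0 Ks]; first by rewrite ffunE.
have := hB (B + 1) ltac:(lra) _ Ks.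
rewrite /= /Num.norm /= mx_normrE => le.
have := le_trans (le_bigmax _ _ (ord0, i)) le.
rewrite /= mxE ger0_norm ?divr_ge0 // ler_pdivrMr ?ltr0n ?lt0n // => h.
rewrite -(ler_nat R) natrM; apply: le_trans h _; apply: ler_wpM2r => //.
by apply/ltW; exact: truncnS_gt.
Qed.

(** Otherwise the sum of squares is at most n eps^2 / (n + 1)^2 <= eps^2. Dividing by n + 1 rather
    than n stays meaningful for n = 0. *)
Lemma euclidean_norm_gt (R : realType) n (v : 'rV[Cplx R]_n) (eps : R) :
  0 < eps -> eps < euclidean_norm v -> exists j, eps / n.+1%:R < cabs (v 0 j).
Proof.
move=> e0; apply: contraPP => /forallNP h; apply/negP; rewrite -leNgt.
have n0 : 0 < n.+1%:R :> R by [].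
have q0 := divr_gt0 e0 n0.
rewrite /euclidean_norm -[leRHS](gtr0_norm e0) -sqrtr_sqr; apply: ler_wsqrtr.
apply: (@le_trans _ _ (\sum_(j < n) (eps / n.+1%:R) ^+ 2)).
  apply: ler_sum => j _; apply: lerXn2r; rewrite ?nnegrE ?cabs_ge0 //.
    exact: ltW.
  by have /negP := h j; rewrite -leNgt.
rewrite sumr_const card_ord expr_div_n -[leLHS]mulr_natl mulrCA.
rewrite -[leRHS]mulr1; apply: ler_wpM2l; first exact: sqr_ge0.
rewrite ler_pdivrMr ?exprn_gt0 // mul1r -natrX ler_nat.
by apply: leq_trans (leqnSn n) _; rewrite leq_pmulr.
Qed.

Section SliceDistribution.
Variables (R : realType) (n M : nat) (a : multiindex n.+1 -> R).
Hypothesis a_ge0 : forall s, 0 <= a s.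
Hypothesis a_supp : forall s, a s != 0 -> forall i, (s i <= M * s ord_max)%N.

Lemma slice_distribution_ge0 k A : (0 <= slice_distribution a k A)%E.
Proof.
apply: esum_ge0 => s _; rewrite lee_fin divr_ge0 // (slice_total_sum a_ge0 a_supp).
exact: slice_sum_ge0.
Qed.

(** Union bound over the coordinates. Indices of a finite set [J] that fall outside the box [slice]
    have coefficient 0. *)
Lemma slice_distribution_le (m : 'I_n -> R) (d : R) k (A : set (multiindex n)) :
  (forall s : multiindex n.+1, A (initial s) -> exists j, deviates j (m j) d k s) ->
  (slice_distribution a k A <=
   (\sum_(j < n) (\sum_(s <- slice n M k | deviates j (m j) d k s) a s)
      / slice_sum M a k)%:E)%E.
Proof.
move=> hA; apply/esum_leP => J JA; rewrite (slice_total_sum a_ge0 a_supp).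
rewrite -!mulr_suml; apply: ler_wpM2r; first by rewrite invr_ge0 slice_sum_ge0.
apply: (@le_trans _ _ (\sum_(j < n) \sum_(s <- J) if deviates j (m j) d k s then a s else 0)).
  rewrite exchange_big /= big_seq [leRHS]big_seq; apply: ler_sum => s /JA[_ /hA[j dj]].
  rewrite (bigD1 j) //= dj lerDl; apply: sumr_ge0 => i _; by case: ifP.
apply: ler_sum => j _; rewrite [leRHS]big_mkcond /=.
have F0 s : 0 <= if deviates j (m j) d k s then a s else 0 by case: ifP.
apply: le_trans (sum_degree_le (slice n M) J k F0).
rewrite [leRHS]big_mkcond /= big_seq [leRHS]big_seq; apply: ler_sum => s /JA[sk _].
have [//|nsk] := boolP (s \in slice n M k); case: ifP => // _.
have [->//|as0] := eqVneq (a s) 0.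
case/negP: nsk; rewrite mem_slice sk eqxx /=; apply/forallP => i.
by rewrite -sk; exact: a_supp.
Qed.

End SliceDistribution.

Theorem mainTheorem4 (R : realType) (n : nat) (a : multiindex n.+1 -> R)
  (K : set 'rV[R]_n.+1) (x0 : Cplx R)
  (U : set 'rV[Cplx R]_n.+1) (G H : 'rV[Cplx R]_n.+1 -> Cplx R)
  (r : 'rV[Cplx R]_n.+1) (eps : R) :
  (forall s, 0 <= a s) ->
  compact K ->
  (forall s, ~ ratio_in K s -> a s = 0) ->
  strictly_convex (log_domain a) ->
  let f := fun t : Cplx R => psum a (ones_last n t) in
  unique_minimal_singularity [set t | abs_convergent a (ones_last n t)] f x0 ->
  simple_pole f x0 ->
  let x := ones_last n x0 in
  open U ->
  closed_polydisk x `<=` U ->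
  analytic_on U G ->
  analytic_on U H ->
  relatively_prime U G H ->
  square_free U H ->
  (forall z, U z -> convergence_domain a z -> H z != 0 ->
     psum a z = G z / H z) ->
  represents (log_gradient H x) r ->
  0 < eps ->
  slice_distribution a k
    [set s : multiindex n |
       eps < euclidean_norm
               ((\row_j ((s j)%:R / k%:R)) - mean_vector r)]
    @[k --> \oo] --> 0%E.
Proof.
move=> a0 Kc aK _ f [x00 fE _ freg] fpole x Uo xU Gan Han _ _ GH [lg0 [q q0 rE]] eps0.
have [M aM] := compact_ratio_bound Kc aK.
have hf t : cabs t < cabs x0 -> cvgC (polysum (fun k => ofR (slice_sum M a k)) t) (f t).
  by rewrite -lt_norm_cabs => /fE[ct _]; exact: psum_ones.
have [x0E [kappa kappa0 Ccvg]] :=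
  simple_pole_coef (slice_sum_ge0 M a0) x00 hf freg fpole.
move: (cabs x0) (cabs_gt0 x0) x0E Ccvg hf => rho0; rewrite x00 => rho0_gt0 x0E Ccvg hf.
have bd (t : R) : 0 <= t < rho0 -> exists B : R, forall N,
    \sum_(k < N) slice_sum M a k * t ^+ k <= B.
  move=> /andP[t0 t1].
  by apply: real_series_bounded (hf (ofR t) _); rewrite cabs_ofR ger0_norm.
have Ux : U x by apply: xU => i.
have [c [C [rr rr0 hT]]] := analytic_at_taylor1 (Han x Ux).
have dH i : 'D_('e_i) H x = c i := derive_axis i rr0 hT.
have xE : x = ones_last n (ofR rho0) by rewrite /x x0E.
have cE i : log_gradient H x 0 i = x 0 i * c i by rewrite mxE dH.
have slope_data j := @radius_slope R n M a a0 aM rho0 kappa rho0_gt0 kappa0 bd Ccvg j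
  U G H Uo.
have last0_data j := @last_derivative_eq0 R n M a a0 aM rho0 kappa rho0_gt0 kappa0 bd
  Ccvg j U G H Uo.
rewrite -xE in slope_data last0_data.
(* The contradiction is with the nonzero log gradient demanded by [represents]. *)
have c_last : c ord_max != 0.
  apply: contraNneq lg0 => c0; apply/eqP/rowP => i; rewrite cE [RHS]mxE.
  case: (unliftP ord_max i) => [j ->|->]; last by rewrite c0 mulr0.
  by rewrite (last0_data j Ux Gan Han GH c C rr rr0 hT c0) mulr0.
have [m hm] := choice (fun j => slope_data j Ux Gan Han GH c C rr rr0 hT c_last).
(* The scalar q cancels in the quotient, and x_j = 1, x_d = rho0 turn it into c_j / (rho0 c_d). *)
have mean j : mean_vector r 0 j = ofR (m j).
  rewrite mxE rE !mxE !dH (hm j).1 ofRM eqxx lift_max_neq mul1r x0E.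
  have : ofR rho0 != 0 by rewrite ofR_eq0 gt_eqF.
  by move: (ofR rho0) (ofR (m j)) => y z y0; field; rewrite q0 c_last y0.
pose d := eps / n.+1%:R.
have d0 : 0 < d by rewrite divr_gt0.
pose g j k := (\sum_(s <- slice n M k | deviates j (m j) d k s) a s) / slice_sum M a k.
have g0 j : g j @ \oo --> (0 : R).
  have [_ [D D0 [l0 l00 hl]]] := hm j.
  exact: (slice_concentration a0 rho0_gt0 kappa0 Ccvg D0 l00 hl).
have gs : (fun k => (\sum_(j < n) g j k)%:E) @ \oo --> (0 : \bar R)%E.
  apply: cvg_EFin; first exact: nearW.
  elim: (index_enum _) => [|j js IH].
    rewrite (_ : fine \o _ = fun=> 0); first exact: cvg_cst.
    by apply/funext => k /=; rewrite big_nil.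
  rewrite (_ : fine \o _ = fun k => g j k + \sum_(i <- js) g i k).
    by rewrite -[0 in X in _ --> X]addr0; apply: cvgD.
  by apply/funext => k /=; rewrite big_cons.
apply: (squeeze_cvge _ (cvg_cst _) gs); apply: nearW => k.
rewrite (slice_distribution_ge0 a0 aM) /=.
apply: (slice_distribution_le a0 aM) => s /(euclidean_norm_gt eps0)[j].
move=> h; exists j; move: h; rewrite mxE [X in cabs (X + _)]mxE [X in cabs (_ + X)]mxE.
by rewrite mean ffunE -!ofR_nat -ofRV -ofRM -ofRB cabs_ofR.
Qed.
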